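(* Let $q$ be an odd prime power and $\Gamma=Sp_4(\mathbb F_q[T])$ (the $4\times4$ matrices $A$ over $\mathbb F_q[T]$ with $A^tJA=J$, $J$ having $J_{14}=J_{23}=1$, $J_{32}=J_{41}=-1$, other entries $0$). There exists a length function $\ell$ on $\Gamma$, bi-Lipschitz equivalent to its word length, such that for every $p\in(4,\infty)$ the constant function $1$ on $\Gamma$ is not the pointwise limit of any family $(f_\alpha)_{\alpha\in I}$ of finitely supported $\ell$-radial functions on $\Gamma$ with $\sup_\alpha\|m_{f_\alpha}\|_{MS^p(\ell^2\Gamma)}<\infty$.
   Context: A length function is $\ell:\Gamma\to\mathbb R_{\ge0}$ with $\ell(\gamma\gamma')\le\ell(\gamma)+\ell(\gamma')$; $f$ is $\ell$-radial if $f(\gamma)=f(\gamma')$ whenever $\ell(\gamma)=\ell(\gamma')$. For $f:\Gamma\to\mathbb C$, $m_f$ is the Schur multiplier $(T_{x,y})_{x,y\in\Gamma}\mapsto(f(x^{-1}y)T_{x,y})$ and $\|m_f\|_{MS^p(\ell^2\Gamma)}$ is its (not necessarily completely bounded) operator norm on the Schatten class $S^p(\ell^2\Gamma)$. *)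

(* Defs.v *)
From HB Require Import structures.
From mathcomp Require Import all_boot all_order all_algebra.
From mathcomp Require Import all_classical all_reals all_analysis.
From mathcomp Require Import complex.
Set Implicit Arguments. Unset Strict Implicit. Unset Printing Implicit Defensive.
Import Order.TTheory GRing.Theory Num.Theory.
Local Open Scope ring_scope.

Section Sp4.
Variable F : finFieldType.

Definition Jsp : 'M[{poly F}]_4 :=
  \matrix_(i < 4, j < 4)
    (if ((i == 0 :> nat) && (j == 3 :> nat)) || ((i == 1 :> nat) && (j == 2 :> nat)) then 1
     else if ((i == 2 :> nat) && (j == 1 :> nat)) || ((i == 3 :> nat) && (j == 0 :> nat)) then -1
     else 0).

Definition inSp4 (A : 'M[{poly F}]_4) : bool := A^T *m Jsp *m A == Jsp.

Definition ginv (A : 'M[{poly F}]_4) := invmx A.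

Definition letter (a : bool * 'M[{poly F}]_4) := if a.1 then ginv a.2 else a.2.
Definition wprod (w : seq (bool * 'M[{poly F}]_4)) : 'M[{poly F}]_4 :=
  foldr (fun a m => letter a *m m) 1%:M w.
Definition word_over (S : seq 'M[{poly F}]_4) (w : seq (bool * 'M[{poly F}]_4)) :=
  all (fun a => a.2 \in S) w.

Variable R : realType.

Definition length_fun (l : 'M[{poly F}]_4 -> R) : Prop :=
  (forall g, inSp4 g -> 0 <= l g) /\
  (forall g h, inSp4 g -> inSp4 h -> l (g *m h) <= l g + l h).

(* l is bi-Lipschitz equivalent to the word length |.|_S of the finite
   generating set S:  C^{-1} |g|_S <= l g <= C |g|_S, where |g|_S is the
   minimal length of a word over S \cup S^{-1} representing g (written out:
   every word for g bounds l g, and some word for g is short); the second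
   clause in particular says that S generates Gamma. *)
Definition bilip_word (l : 'M[{poly F}]_4 -> R) (S : seq 'M[{poly F}]_4) : Prop :=
  exists C : R, 0 < C /\
    (forall g, inSp4 g -> forall w, word_over S w -> wprod w = g ->
        l g <= C * (size w)%:R) /\
    (forall g, inSp4 g -> exists w, [/\ word_over S w, wprod w = g &
        (size w)%:R <= C * l g]).

Definition radial (l : 'M[{poly F}]_4 -> R) (f : 'M[{poly F}]_4 -> R[i]) : Prop :=
  forall g h, inSp4 g -> inSp4 h -> l g = l h -> f g = f h.

Definition fin_supp (f : 'M[{poly F}]_4 -> R[i]) : Prop :=
  exists s : seq 'M[{poly F}]_4, forall g, inSp4 g -> f g != 0 -> g \in s.

End Sp4.

Section Schatten.
Variables (R : realType) (X : eqType) (D : pred X).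
Local Open Scope ereal_scope.

Definition cmod (z : R[i]) : R := ComplexField.Normc.normc z.

Definition finsub (s : seq X) := uniq s && all D s.

Definition l2n (s : seq X) (xi : X -> R[i]) : R :=
  Num.sqrt (\sum_(x <- s) cmod (xi x) ^+ 2)%R.

Definition bform (T : X -> X -> R[i]) (s : seq X) (xi eta : X -> R[i]) : R[i] :=
  (\sum_(x <- s) \sum_(y <- s) Num.conj (eta x) * T x y * xi y)%R.

(* operator norm on l^2(D) (+oo if the matrix is unbounded): supremum of
   |<eta, T xi>| over finitely supported xi, eta in the unit ball of l^2(D)
   (finitely supported vectors are dense in l^2(D)) *)
Definition opnorm (T : X -> X -> R[i]) : \bar R :=
  ereal_sup [set e | exists s xi eta, [/\ finsub s, (l2n s xi <= 1)%R,
     (l2n s eta <= 1)%R & e = (cmod (bform T s xi eta))%:E] ].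

Definition rank_le (n : nat) (Rm : X -> X -> R[i]) : Prop :=
  exists (u v : 'I_n -> X -> R[i]), forall x y, D x -> D y ->
    Rm x y = (\sum_(i < n) u i x * v i y)%R.

(* n-th singular value (n >= 0), defined as the approximation number
   s_n(T) = inf { ||T - Rm|| : rank Rm <= n }   (so s_0(T) = ||T||) *)
Definition sing (T : X -> X -> R[i]) (n : nat) : \bar R :=
  ereal_inf [set opnorm (fun x y => T x y - Rm x y)%R | Rm in rank_le n].

(* Schatten p-norm  ||T||_{S^p} = (sum_n s_n(T)^p)^{1/p}  (+oo if T is not in S^p) *)
Definition spnorm (p : R) (T : X -> X -> R[i]) : \bar R :=
  (ereal_sup (range (fun N : nat => \sum_(n < N) (sing T n) `^ p))) `^ (p^-1)%R.

End Schatten.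

Section Schur.
Variables (F : finFieldType) (R : realType).
Local Open Scope ereal_scope.

Definition schur (f : 'M[{poly F}]_4 -> R[i]) (T : 'M[{poly F}]_4 -> 'M[{poly F}]_4 -> R[i]) :=
  fun x y => (f (ginv x *m y) * T x y)%R.

Definition schur_norm (p : R) (f : 'M[{poly F}]_4 -> R[i]) : \bar R :=
  ereal_inf [set c%:E | c in [set c : R | (0 <= c)%R /\
     forall T, spnorm (@inSp4 F) p T < +oo ->
       spnorm (@inSp4 F) p (schur f T) <= c%:E * spnorm (@inSp4 F) p T]].

End Schur.

Definition directed_set (I : Type) (le : I -> I -> Prop) : Prop :=
  [/\ (exists a : I, True), (forall a, le a a),
      (forall a b c, le a b -> le b c -> le a c) &
      (forall a b, exists c, le a c /\ le b c)].

Definition net_to_one (F : finFieldType) (R : realType) (I : Type)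
  (le : I -> I -> Prop) (f : I -> 'M[{poly F}]_4 -> R[i]) : Prop :=
  forall g, inSp4 g -> forall eps : R, 0 < eps ->
    exists a0, forall a, le a0 a -> cmod (f a g - 1) < eps.

(* Main.v *)
Require Import Defs.
From HB Require Import structures.
From mathcomp Require Import all_boot all_order all_algebra.
From mathcomp Require Import all_fingroup cyclic.
From mathcomp Require Import all_classical all_reals all_analysis.
From mathcomp Require Import complex zify ring lra.
Set Implicit Arguments.
Unset Strict Implicit.
Unset Printing Implicit Defensive.
Import Order.TTheory GRing.Theory Num.Theory.
Local Open Scope ring_scope.

(* The length of [g <> 1] is its maximal entry size [msize g] (degree plus one).

   Every [g] of degree [n] is a word of length [O(n)].  In the Heisenberg group
   [heis u v z] (the unipotent radical of the stabiliser of a line), conjugation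
   by a fixed hyperbolic element of the Levi [SL_2] produces the Chebyshev basis
   [U_j] of [F[T]], so Horner's scheme writes [heis P * *] with [O(deg P)]
   letters; one commutator isolates a coordinate and a second one (where the odd
   characteristic is used) the centre.  Euclid's algorithm on columns then
   reduces an arbitrary [g] to [heis], each division costing its quotient degree.

   A radial [f] with values [phi k] on elements of degree [k] satisfies
   [|phi k - phi (k + 1)| = O(rho ^ k)].  Test the multiplier on the matrix
   indexed by points [(x, y)] and lines [(a, b)], with [x, y, a, b] polynomials of
   degree at most [n], whose entry [alpha w / q ^ (n + 1)] depends on the coefficients
   [w] of degree at least [n] of [T^n (b - y) - x a], [alpha] being the difference
   of the indicators of [w = 0] and [w = 1].  Its Gram matrix is supported on equal
   [x], so the norm is at most [2 q ^ (-(n + 1) / 2)], and its rank is at most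
   [q ^ (2 (n + 1))]; hence its [S^p] norm decays exactly when [p > 4].  Heisenberg
   elements realise the entries so that [w = 0] and [w = 1] give two consecutive
   degrees, and the constant vector reads off [phi k - phi (k + 1)].  If [phi] has
   finite support then [|phi k| = O(rho ^ k)] uniformly, so the limit is not 1. *)

(** * Symplectic 4x4 matrices *)

Section FourByFour.
Variable R : comNzRingType.

Definition mx4 (a00 a01 a02 a03 a10 a11 a12 a13
                a20 a21 a22 a23 a30 a31 a32 a33 : R) : 'M[R]_4 :=
  \matrix_(i < 4, j < 4)
    nth 0 (nth [::] [:: [:: a00; a01; a02; a03]; [:: a10; a11; a12; a13];
                        [:: a20; a21; a22; a23]; [:: a30; a31; a32; a33]] i) j.

Lemma mx4_mul a00 a01 a02 a03 a10 a11 a12 a13 a20 a21 a22 a23 a30 a31 a32 a33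
    b00 b01 b02 b03 b10 b11 b12 b13 b20 b21 b22 b23 b30 b31 b32 b33 :
  mx4 a00 a01 a02 a03 a10 a11 a12 a13 a20 a21 a22 a23 a30 a31 a32 a33 *m
  mx4 b00 b01 b02 b03 b10 b11 b12 b13 b20 b21 b22 b23 b30 b31 b32 b33 =
  mx4 (a00 * b00 + a01 * b10 + a02 * b20 + a03 * b30)
      (a00 * b01 + a01 * b11 + a02 * b21 + a03 * b31)
      (a00 * b02 + a01 * b12 + a02 * b22 + a03 * b32)
      (a00 * b03 + a01 * b13 + a02 * b23 + a03 * b33)
      (a10 * b00 + a11 * b10 + a12 * b20 + a13 * b30)
      (a10 * b01 + a11 * b11 + a12 * b21 + a13 * b31)
      (a10 * b02 + a11 * b12 + a12 * b22 + a13 * b32)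
      (a10 * b03 + a11 * b13 + a12 * b23 + a13 * b33)
      (a20 * b00 + a21 * b10 + a22 * b20 + a23 * b30)
      (a20 * b01 + a21 * b11 + a22 * b21 + a23 * b31)
      (a20 * b02 + a21 * b12 + a22 * b22 + a23 * b32)
      (a20 * b03 + a21 * b13 + a22 * b23 + a23 * b33)
      (a30 * b00 + a31 * b10 + a32 * b20 + a33 * b30)
      (a30 * b01 + a31 * b11 + a32 * b21 + a33 * b31)
      (a30 * b02 + a31 * b12 + a32 * b22 + a33 * b32)
      (a30 * b03 + a31 * b13 + a32 * b23 + a33 * b33).
Proof.
apply/matrixP=> i j; rewrite !mxE !big_ord_recr big_ord0 /= !mxE /= add0r.
by case: i => [[|[|[|[|//]]]] ?]; case: j => [[|[|[|[|//]]]] ?].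
Qed.

Lemma mx4_tr a00 a01 a02 a03 a10 a11 a12 a13 a20 a21 a22 a23 a30 a31 a32 a33 :
  (mx4 a00 a01 a02 a03 a10 a11 a12 a13 a20 a21 a22 a23 a30 a31 a32 a33)^T =
  mx4 a00 a10 a20 a30 a01 a11 a21 a31 a02 a12 a22 a32 a03 a13 a23 a33.
Proof.
apply/matrixP=> i j; rewrite !mxE.
by case: i => [[|[|[|[|//]]]] ?]; case: j => [[|[|[|[|//]]]] ?].
Qed.

Lemma mx4_scalar a : a%:M = mx4 a 0 0 0 0 a 0 0 0 0 a 0 0 0 0 a.
Proof.
apply/matrixP=> i j; rewrite !mxE.
by case: i => [[|[|[|[|//]]]] ?]; case: j => [[|[|[|[|//]]]] ?].
Qed.

Lemma mx4_eta (A : 'M[R]_4) :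
  A = mx4 (A 0 0) (A 0 1) (A 0 2) (A 0 3) (A 1 0) (A 1 1) (A 1 2) (A 1 3)
          (A 2 0) (A 2 1) (A 2 2) (A 2 3) (A 3 0) (A 3 1) (A 3 2) (A 3 3).
Proof.
apply/matrixP=> i j; rewrite !mxE.
by case: i => [[|[|[|[|//]]]] ?]; case: j => [[|[|[|[|//]]]] ?] /=;
  congr (A _ _); apply/val_inj.
Qed.

End FourByFour.

Section Symplectic.
Variable F : finFieldType.
Local Notation pF := {poly F}.

Lemma JspE : Jsp F = mx4 0 0 0 1 0 0 1 0 0 (-1) 0 0 (-1) 0 0 0.
Proof.
apply/matrixP=> i j; rewrite !mxE.
by case: i => [[|[|[|[|//]]]] ?]; case: j => [[|[|[|[|//]]]] ?].
Qed.

Lemma Jsp_sqr : Jsp F *m Jsp F = - 1%:M.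
Proof.
rewrite JspE mx4_mul -(scalemx1 _ 1) -scaleNr scalemx1 mx4_scalar; congr mx4; ring.
Qed.

Lemma inSp4P (A : 'M[pF]_4) : reflect (A^T *m Jsp F *m A = Jsp F) (inSp4 A).
Proof. exact: eqP. Qed.

Lemma inSp4_1 : inSp4 (1%:M : 'M[pF]_4).
Proof. by apply/inSp4P; rewrite trmx1 mul1mx mulmx1. Qed.

Lemma inSp4M (A B : 'M[pF]_4) : inSp4 A -> inSp4 B -> inSp4 (A *m B).
Proof.
move=> /inSp4P hA /inSp4P hB; apply/inSp4P.
by rewrite trmx_mul !mulmxA -(mulmxA _ _ (Jsp F)) -(mulmxA _ _ A) hA.
Qed.

Lemma inSp4_linv (A : 'M[pF]_4) : inSp4 A -> - (Jsp F *m A^T *m Jsp F) *m A = 1%:M.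
Proof.
move=> /inSp4P hA; rewrite mulNmx -!mulmxA (mulmxA A^T) hA Jsp_sqr.
exact: opprK.
Qed.

Lemma inSp4_unit (A : 'M[pF]_4) : inSp4 A -> A \in unitmx.
Proof. by move/inSp4_linv/mulmx1_unit => []. Qed.

Lemma ginvE (A : 'M[pF]_4) : inSp4 A -> ginv A = - (Jsp F *m A^T *m Jsp F).
Proof.
by move=> hA; rewrite -[RHS]mulmx1 -(mulmxV (inSp4_unit hA)) mulmxA inSp4_linv ?mul1mx.
Qed.

Lemma ginvM_eq (A B C : 'M[pF]_4) : inSp4 A -> B = A *m C -> ginv A *m B = C.
Proof. by move=> hA ->; rewrite /ginv mulKmx ?inSp4_unit. Qed.

Lemma inSp4V (A : 'M[pF]_4) : inSp4 A -> inSp4 (ginv A).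
Proof.
move=> hA; have u := inSp4_unit hA; apply/inSp4P.
move/inSp4P: hA => hA.
by rewrite -{1}hA !mulmxA -trmx_mul mulmxV // trmx1 mul1mx -mulmxA mulmxV // mulmx1.
Qed.

(** The matrix [A^T J A] is alternating, so its six entries above the diagonal determine it. *)
Lemma inSp4_mx4 a00 a01 a02 a03 a10 a11 a12 a13 a20 a21 a22 a23 a30 a31 a32 a33 :
  inSp4 (mx4 a00 a01 a02 a03 a10 a11 a12 a13 a20 a21 a22 a23 a30 a31 a32 a33 : 'M[pF]_4) <->
  [/\ a00 * a31 + a10 * a21 - a20 * a11 - a30 * a01 = 0,
      a00 * a32 + a10 * a22 - a20 * a12 - a30 * a02 = 0 &
      a00 * a33 + a10 * a23 - a20 * a13 - a30 * a03 = 1] /\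
  [/\ a01 * a32 + a11 * a22 - a21 * a12 - a31 * a02 = 1,
      a01 * a33 + a11 * a23 - a21 * a13 - a31 * a03 = 0 &
      a02 * a33 + a12 * a23 - a22 * a13 - a32 * a03 = 0].
Proof.
split=> [/inSp4P|[[h1 h2 h3] [h4 h5 h6]]]; last apply/inSp4P.
  rewrite JspE mx4_tr !mx4_mul => /matrixP h.
  move: (h 0 1) (h 0 2) (h 0 3) (h 1 2) (h 1 3) (h 2 3).
  rewrite !mxE /= => e1 e2 e3 e4 e5 e6.
  split; split; [rewrite -[RHS]e1|rewrite -[RHS]e2|rewrite -[RHS]e3
                |rewrite -[RHS]e4|rewrite -[RHS]e5|rewrite -[RHS]e6]; ring.
rewrite JspE mx4_tr !mx4_mul.
congr mx4; first [ring
  | by rewrite -[RHS]h1; ring | by rewrite -[RHS]h2; ring | by rewrite -[RHS]h3; ring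
  | by rewrite -[RHS]h4; ring | by rewrite -[RHS]h5; ring | by rewrite -[RHS]h6; ring
  | apply: oppr_inj; rewrite ?oppr0 ?opprK; first
    [ by rewrite -[RHS]h1; ring | by rewrite -[RHS]h2; ring | by rewrite -[RHS]h3; ring
    | by rewrite -[RHS]h4; ring | by rewrite -[RHS]h5; ring | by rewrite -[RHS]h6; ring]].
Qed.
End Symplectic.

(** * Word length *)

Lemma mulmx4E (R : comNzRingType) (A B : 'M[R]_4) i k :
  (A *m B) i k = A i 0 * B 0 k + A i 1 * B 1 k + A i 2 * B 2 k + A i 3 * B 3 k.
Proof.
rewrite mxE !big_ord_recr big_ord0 /= add0r.
by congr (_ * _ + _ * _ + _ * _ + _ * _); congr (_ _ _); apply/val_inj.
Qed.

Section WordLength.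
Variable F : finFieldType.
Local Notation pF := {poly F}.
Implicit Types (A B g s : 'M[pF]_4) (u v z P Q : pF).

Definition msize A : nat := \max_i \max_j size (A i j).

Lemma msize_leP A n : reflect (forall i j, (size (A i j) <= n)%N) (msize A <= n)%N.
Proof.
apply: (iffP (bigmax_leqP _ _ _)) => [h i j|h i _]; last exact/bigmax_leqP.
by move/bigmax_leqP: (h i isT); apply.
Qed.

Lemma size_le_msize A i j : (size (A i j) <= msize A)%N.
Proof. by have /msize_leP := leqnn (msize A). Qed.

Lemma msize_mx4 a00 a01 a02 a03 a10 a11 a12 a13 a20 a21 a22 a23 a30 a31 a32 a33 n :
  all (fun a : pF => (size a <= n)%N)
    [:: a00; a01; a02; a03; a10; a11; a12; a13; a20; a21; a22; a23; a30; a31; a32; a33] ->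
  (msize (mx4 a00 a01 a02 a03 a10 a11 a12 a13 a20 a21 a22 a23 a30 a31 a32 a33) <= n)%N.
Proof.
move=> /= h; apply/msize_leP => i j; rewrite mxE; move: h.
by case: i => [[|[|[|[|//]]]] ?]; case: j => [[|[|[|[|//]]]] ?] /=; do 16?[case/andP=> ?].
Qed.

Lemma msizeM A B : (msize (A *m B) <= (msize A + msize B).-1)%N.
Proof.
apply/msize_leP => i j; rewrite mxE; apply: (leq_trans (size_sum _ _ _)).
apply/bigmax_leqP => k _; apply: (leq_trans (size_polyMleq _ _)).
by rewrite -!subn1 leq_sub2r // leq_add // size_le_msize.
Qed.

Lemma msize_gt0 A : A != 0 -> (0 < msize A)%N.
Proof.
apply: contraNltn; rewrite leqn0 => /eqP h; apply/eqP/matrixP => i j.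
by apply/eqP; rewrite mxE -size_poly_eq0 -leqn0 (leq_trans (size_le_msize A i j)) ?h.
Qed.

Lemma inSp4_neq0 A : inSp4 A -> A != 0.
Proof.
move=> /inSp4P h; apply/eqP => A0; move: h; rewrite A0 mulmx0 JspE => /matrixP /(_ 0 3).
by rewrite !mxE /= => /esym/eqP; rewrite oner_eq0.
Qed.

Lemma msize1 : msize 1%:M = 1%N.
Proof.
apply/eqP; rewrite eqn_leq msize_gt0 ?inSp4_neq0 ?inSp4_1 // andbT.
by rewrite mx4_scalar; apply: msize_mx4; rewrite /= size_poly0 size_poly1.
Qed.

(** Since [ginv A = - J A^T J], inversion only moves the entries and changes signs. *)
Lemma msize_ginv A : inSp4 A -> (msize (ginv A) <= msize A)%N.
Proof.
move=> hA; rewrite ginvE //.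
have hJ : (msize (Jsp F) <= 1)%N.
  by rewrite JspE; apply: msize_mx4; rewrite /= ?size_polyN size_poly0 size_poly1.
have hT : (msize A^T <= msize A)%N by apply/msize_leP => i j; rewrite mxE size_le_msize.
suff : (msize (Jsp F *m A^T *m Jsp F) <= msize A)%N.
  by move=> /msize_leP h; apply/msize_leP => i j; rewrite mxE size_polyN.
by have := msizeM (Jsp F *m A^T) (Jsp F); have := msizeM (Jsp F) A^T; lia.
Qed.

(** A row of length 2 encodes a polynomial of degree at most one, so the candidates form a finite
    type that can be enumerated. *)
Definition gens : seq 'M[pF]_4 :=
  [seq A <- [seq map_mx rVpoly M | M : 'M['rV[F]_2]_4] | inSp4 A].

Lemma mem_gens A : (A \in gens) = inSp4 A && (msize A <= 2)%N.
Proof.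
rewrite mem_filter; case: inSp4 => //=; apply/idP/idP => [/mapP[M _ ->]|/msize_leP h].
  by apply/msize_leP => i j; rewrite mxE size_poly.
apply/mapP; exists (map_mx poly_rV A); rewrite ?mem_enum //; apply/matrixP => i j.
by rewrite !mxE poly_rV_K.
Qed.

Lemma gens_inSp4 : all (@inSp4 F) gens.
Proof. by apply/allP => A; rewrite mem_gens => /andP[]. Qed.

Definition short n g := exists w, [/\ word_over gens w, wprod w = g & (size w <= n)%N].

Lemma short_leq n m g : (n <= m)%N -> short n g -> short m g.
Proof. by move=> h [w [? ? /leq_trans h']]; exists w; split=> //; apply: h'. Qed.

Lemma short1 n : short n 1%:M.
Proof. by exists [::]. Qed.

Lemma shortM n m g h : short n g -> short m h -> short (n + m) (g *m h).
Proof.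
move=> [w [w1 <- w3]] [w' [w1' <- w3']]; exists (w ++ w'); split.
- by have := w1; rewrite /word_over all_cat => ->.
- by elim: w {w1 w3} => [|a w IH] /=; rewrite ?mul1mx // IH mulmxA.
- by rewrite size_cat leq_add.
Qed.

Lemma short_gen g : inSp4 g -> (msize g <= 2)%N -> short 1 g.
Proof.
move=> h1 h2; exists [:: (false, g)]; split=> //=; last exact: mulmx1.
by rewrite /word_over /= mem_gens h1 h2.
Qed.

Lemma short_letter a : a.2 \in gens -> short 1 (letter a).
Proof.
rewrite mem_gens => /andP[h1 h2]; apply: short_gen; rewrite /letter; case: ifP => // _.
  exact: inSp4V.
exact: leq_trans (msize_ginv h1) h2.
Qed.

Lemma short_inSp4 n g : short n g -> inSp4 g.
Proof.
case=> w [h <- _]; elim: w h => [_|a w IH /= /andP[ha /IH hw]]; first exact: inSp4_1.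
apply: inSp4M => //; move: ha; rewrite mem_gens => /andP[ha _].
by rewrite /letter; case: ifP => // _; apply: inSp4V.
Qed.

(** A letter has entries of degree at most one, so it raises the degree by at most one. This is the
    easy half of the bi-Lipschitz comparison. *)
Lemma short_msize n g : short n g -> (msize g <= n.+1)%N.
Proof.
case=> w [h <- hn]; apply: leq_trans (_ : (size w).+1 <= _)%N => //; move: h.
elim: w {hn} => [_|a w IH /= /andP[ha /IH hw]]; first by rewrite msize1.
have h2 : (msize (letter a) <= 2)%N.
  move: ha; rewrite mem_gens => /andP[h1 h2]; rewrite /letter; case: ifP => // _.
  exact: leq_trans (msize_ginv h1) h2.
apply: (leq_trans (msizeM _ _)); lia.
Qed.

Lemma shortV n g : short n g -> short n (ginv g).
Proof.
case=> w [h <- hn]; apply: (short_leq hn) => {hn}.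
elim: w h => [_|a w IH /= /andP[ha hw]]; first by rewrite /ginv invmx1; apply: short1.
have sa := short_letter ha.
have sw : inSp4 (wprod w) by apply: (@short_inSp4 (size w)); exists w.
have -> : ginv (letter a *m wprod w) = ginv (wprod w) *m ginv (letter a).
  have h1 := inSp4_unit (short_inSp4 sa); have h2 := inSp4_unit sw.
  rewrite /ginv -[RHS]mulmx1 -(mulmxV (_ : letter a *m wprod w \in unitmx)) ?unitmx_mul ?h1 //.
  by rewrite !mulmxA mulmxKV // mulVmx // mul1mx.
rewrite -addn1; apply: shortM; first exact: IH.
apply: short_gen; first exact/inSp4V/(short_inSp4 sa).
exact: leq_trans (msize_ginv (short_inSp4 sa)) (short_msize sa).
Qed.

(** * Short words in the Heisenberg group *)

Definition heis u v z : 'M[pF]_4 := mx4 1 u v z 0 1 0 v 0 0 1 (- u) 0 0 0 1.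
Definition levi a b c d : 'M[pF]_4 := mx4 1 0 0 0 0 a b 0 0 c d 0 0 0 0 1.

Lemma heis_inSp4 u v z : inSp4 (heis u v z).
Proof. by apply/inSp4_mx4; split; split; ring. Qed.

Lemma levi_inSp4 a b c d : a * d - b * c = 1 -> inSp4 (levi a b c d).
Proof. by move=> h; apply/inSp4_mx4; split; split; try ring; rewrite -[RHS]h; ring. Qed.

(** The cocycle [u * v' - v * u'] is alternating, so commutators are central with coordinate
    [2 * (u * v' - v * u')]. *)
Lemma heisM u v z u' v' z' :
  heis u v z *m heis u' v' z' = heis (u + u') (v + v') (z + z' + u * v' - v * u').
Proof. by rewrite mx4_mul; congr mx4; ring. Qed.

Lemma heis000 : heis 0 0 0 = 1%:M.
Proof. by rewrite mx4_scalar /heis oppr0. Qed.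

Lemma heisV u v z : ginv (heis u v z) = heis (- u) (- v) (- z).
Proof.
rewrite -[LHS]mulmx1; apply: ginvM_eq; first exact: heis_inSp4.
by rewrite heisM -heis000; congr heis; ring.
Qed.

(** The Levi factor acts by conjugation on the row [(u, v)] through its [SL_2] block and, the
    determinant being 1, fixes the centre. *)
Lemma heis_levi u v z a b c d : a * d - b * c = 1 ->
  heis u v z *m levi a b c d = levi a b c d *m heis (u * a + v * c) (u * b + v * d) z.
Proof.
move=> h; rewrite !mx4_mul; congr mx4; try ring.
  by transitivity (v * (a * d - b * c)); [rewrite h|]; ring.
by transitivity (- u * (a * d - b * c)); [rewrite h|]; ring.
Qed.

Lemma short_heis_levi n u v z a b c d : a * d - b * c = 1 -> short 1 (levi a b c d) ->
  short n (heis u v z) -> short (n + 2) (heis (u * a + v * c) (u * b + v * d) z).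
Proof.
move=> h hl hh; have -> : (n + 2 = 1 + (n + 1))%N by lia.
rewrite -(ginvM_eq (levi_inSp4 h) (heis_levi u v z h)).
by apply: shortM; [apply: shortV | apply: shortM].
Qed.

(** The pair is [(1, 0) B ^ n], where [B] has rows [('X, 1)] and [(-1, 0)]; its entries are the
    monic rescalings of the Chebyshev polynomials [U_n] and [U_(n-1)] of the second kind. *)
Fixpoint chebyshev n : pF * pF :=
  if n is n'.+1 then let: (u, v) := chebyshev n' in (u * 'X - v, u) else (1, 0).

Lemma size_chebyshev n : size (chebyshev n).1 = n.+1 /\ (size (chebyshev n).2 <= n)%N.
Proof.
elim: n => [|n] /=; first by rewrite size_poly1 size_poly0.
case: chebyshev => u v /= [h1 h2]; rewrite h1; split=> //.
have u0 : u != 0 by rewrite -size_poly_eq0 h1.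
rewrite size_polyDl size_mulX // h1 // size_polyN; exact: leq_trans h2 _.
Qed.

Lemma chebyshev_span n P : (size P <= n)%N ->
  exists c : nat -> F, P = \sum_(j < n) c j *: (chebyshev j).1.
Proof.
elim: n P => [|n IH] P hP.
  exists (fun=> 0); rewrite big_ord0; apply/eqP; by rewrite -size_poly_leq0.
have [h1 _] := size_chebyshev n.
set U := (chebyshev n).1 in h1.
have lU : lead_coef U != 0 by rewrite lead_coef_eq0 -size_poly_eq0 h1.
have [|c hc] := IH (P - (P`_n / lead_coef U) *: U).
  apply/leq_sizeP => j; rewrite leq_eqVlt => /orP[/eqP <-|hj].
    have e : U`_n = lead_coef U by rewrite /lead_coef h1.
    by rewrite coefB coefZ e divfK // subrr.
  rewrite coefB coefZ [P`_j]nth_default ?(leq_trans hP) //.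
  by rewrite [U`_j]nth_default ?h1 // mulr0 subr0.
exists (fun j => if j == n then P`_n / lead_coef U else c j).
rewrite big_ord_recr /= eqxx -/U -[LHS](subrK ((P`_n / lead_coef U) *: U)); congr (_ + _).
by rewrite hc; apply: eq_bigr => j _; rewrite ltn_eqF.
Qed.

(** The sum for [n + 1] is [(c 0, 0)] plus [B] applied to the sum for the shifted coefficients: one
    letter for the constant and two for conjugation by [B]. The central coordinate stays
    uncontrolled for now. *)
Lemma short_horner n (c : nat -> F) : exists z, short (n * 3)
  (heis (\sum_(j < n) c j *: (chebyshev j).1) (\sum_(j < n) c j *: (chebyshev j).2) z).
Proof.
elim: n c => [|n IH] c; first by exists 0; rewrite !big_ord0 heis000; apply: short1.
have [z hz] := IH (fun j => c j.+1).
set u := \sum_(j < n) _ in hz; set v := \sum_(j < n) _ in hz.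
have hB : ('X * 0 - 1 * (-1) = 1 :> pF) by ring.
have sB : short 1 (levi 'X 1 (-1) 0).
  apply: short_gen; first exact: levi_inSp4.
  by apply: msize_mx4; rewrite /= ?size_polyN size_poly0 size_poly1 size_polyX.
have sc : short 1 (heis (c 0%N)%:P 0 0).
  apply: short_gen; first exact: heis_inSp4.
  apply: msize_mx4; rewrite /= ?size_polyN !size_poly0 size_poly1 /=.
  by rewrite (leq_trans (size_polyC_leq1 _)).
exists (0 + z + (c 0%N)%:P * (u * 1 + v * 0) - 0 * (u * 'X + v * -1)).
have := shortM sc (short_heis_levi hB sB hz); rewrite heisM.
rewrite !big_ord_recl /= scaler0.
have -> : (n.+1 * 3 = 1 + (n * 3 + 2))%N by lia.
congr (short _ (heis _ _ _)).
- rewrite alg_polyC; congr (_ + _); rewrite !mulr_suml -big_split /=.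
  apply: eq_bigr => j _; case: chebyshev => a b /=.
  by rewrite scalerBr -scalerAl mulrN1.
- congr (_ + _); rewrite mulr1 mulr0 addr0; apply: eq_bigr => j _.
  by case: chebyshev.
Qed.

Lemma levi_const_short (a b c d : F) : a * d - b * c = 1 ->
  short 1 (levi a%:P b%:P c%:P d%:P).
Proof.
move=> h; apply: short_gen.
  by apply: levi_inSp4; rewrite -!polyCM -polyCB h.
apply: msize_mx4; rewrite /= !size_poly0 size_poly1 /=.
by rewrite !(leq_trans (size_polyC_leq1 _)).
Qed.

(** The shear [(u, v) -> (u, u + v)] turns [(P, Q)] into [(P, P + Q)]; multiplying by the inverse of
    the original element leaves [(0, P)]. *)
Lemma short_heis_snd n P : (size P <= n)%N -> exists z, short (6 * n + 2) (heis 0 P z).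
Proof.
move=> /chebyshev_span [c hP].
have [z] := short_horner n c; rewrite -hP; set Q := \sum_(j < n) _ => hz.
have := @levi_const_short 1 1 0 1; rewrite mulr1 mulr0 subr0 => /(_ erefl) sE.
have hE : (1 * 1 - 1 * 0 = 1 :> pF) by ring.
have := shortM (shortV hz) (short_heis_levi hE sE hz); rewrite heisV heisM.
set z' := (X in heis _ _ X); rewrite addnA => h; exists z'.
apply: (@short_leq (n * 3 + n * 3 + 2)); first lia.
by move: h; congr (short _ (heis _ _ _)); ring.
Qed.

(** A quarter turn sends [(0, v)] to [(- v, 0)], hence the passage to [- P]. *)
Lemma short_heis_fst n P : (size P <= n)%N -> exists z, short (6 * n + 4) (heis P 0 z).
Proof.
rewrite -size_polyN => /short_heis_snd [z hz]; exists z.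
have sE : short 1 (levi 0%:P 1%:P (-1)%:P 0%:P) by apply: levi_const_short; ring.
have hE : (0 * 0 - 1 * (-1)%:P = 1 :> pF) by rewrite polyCN; ring.
have := short_heis_levi hE sE hz; rewrite -addnA.
by congr (short _ (heis _ _ _)); rewrite ?polyCN; ring.
Qed.

Hypothesis oddF : odd #|F|.

(** If 2 vanished, 1 would have additive order 2, and Lagrange's theorem would make [#|F|] even. *)
Lemma two_neq0 : 2%:R != 0 :> F.
Proof.
apply/eqP => h2; pose x : F := 1.
have : (#[x]%g %| #|[set: F]|)%N by apply: cardSg; rewrite cycle_subG inE.
have -> : #[x]%g = 2%N.
  by apply: nt_prime_order; rewrite ?oner_neq0 // -zmodXgE.
by rewrite cardsT dvdn2 oddF.
Qed.

(** The commutator of [heis (P / 2) 0 z] and [heis 0 1 0] is [heis 0 0 P]: the uncontrolled [z]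
    cancels. *)
Lemma short_center n P : (size P <= n)%N -> short (12 * n + 10) (heis 0 0 P).
Proof.
move=> hP; have := two_neq0 => h2.
have [|z hz] := @short_heis_fst n ((2%:R^-1)%:P * P).
  apply: leq_trans hP; rewrite mul_polyC; exact: size_scale_leq.
have s1 (e : F) : short 1 (heis 0 e%:P 0).
  apply: short_gen; first exact: heis_inSp4.
  apply: msize_mx4; rewrite /= ?size_polyN !size_poly0 size_poly1 /=.
  by rewrite !(leq_trans (size_polyC_leq1 _)).
have := shortM (shortM hz (s1 1)) (shortM (shortV hz) (s1 (-1))).
rewrite heisV !heisM => h; apply: (@short_leq (6 * n + 4 + 1 + (6 * n + 4 + 1))); first lia.
have e : P = (2%:R^-1)%:P * P + (2%:R^-1)%:P * P.
  by rewrite -mulrDl -polyCD -mulr2n -[_ *+ 2]mulr_natl divff // mul1r.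
by move: h; rewrite [in heis 0 0 P]e polyCN; congr (short _ (heis _ _ _)); ring.
Qed.

Lemma short_heis n u v z : (size u <= n)%N -> (size v <= n)%N -> (size z <= n)%N ->
  short (156 * n + 100) (heis u v z).
Proof.
move=> /short_heis_fst [z1 h1] /short_heis_snd [z2 h2] hz.
have h3 := shortM h1 h2.
(* The central coordinate of the product is unknown, but it is an entry of a word of known length,
   so [short_msize] bounds its size and [short_center] can correct it. *)
have h4 := size_le_msize (heis u 0 z1 *m heis 0 v z2) 0 3.
have {h4} := leq_trans h4 (short_msize h3).
rewrite heisM mxE /=; set z3 := (X in size (polyseq X)) => h4.
have hz3 : (size (z - z3)%R <= 12 * n + 7)%N.
  apply: (leq_trans (size_polyD _ _)); rewrite size_polyN geq_max (leq_trans h4) ?andbT; lia.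
have := shortM h3 (short_center hz3); rewrite heisM -/z3 heisM => h.
apply: (short_leq _ (_ : short (6 * n + 4 + (6 * n + 2) + (12 * (12 * n + 7) + 10)) _)); first lia.
by move: h; congr (short _ (heis _ _ _)); rewrite /z3; ring.
Qed.

(** The permutation [s] conjugates the centre of the Heisenberg group, entry [(0, 3)], onto the root
    subgroup of entry [(1, 2)]. *)
Lemma short_levi_upper n P : (size P <= n)%N -> short (12 * n + 12) (levi 1 P 0 1).
Proof.
move=> /short_center h; pose s : 'M[pF]_4 := mx4 0 1 0 0 1 0 0 0 0 0 0 1 0 0 1 0.
have hs : short 1 s.
  apply: short_gen; first by apply/inSp4_mx4; split; split; ring.
  by apply: msize_mx4; rewrite /= size_poly0 size_poly1.
apply: (short_leq _ (_ : short (1 + (12 * n + 10 + 1)) _)); first lia.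
have -> : levi 1 P 0 1 = s *m (heis 0 0 P *m s) by rewrite !mx4_mul; congr mx4; ring.
exact: shortM hs (shortM h hs).
Qed.

(* Euclid's algorithm on the entries [g i k] and [g j k]: [up P] adds [P] times
   row [j] to row [i], [w] is a Weyl element exchanging these rows up to sign.
   The bound follows the potential [size (g i k) + 2 * size (g j k)]. *)
Lemma euclid_column (up : pF -> 'M[pF]_4) (w : 'M[pF]_4) (i j k : 'I_4)
    (D : 'M[pF]_4 -> Prop) (C : nat) :
  (forall P, short (C * (size P).+1) (up P)) -> short 1 w ->
  (forall P g, D g -> D (up P *m g)) -> (forall g, D g -> D (w *m g)) ->
  (forall P g, D g -> (up P *m g) i k = g i k + P * g j k) ->
  (forall P g, D g -> (up P *m g) j k = g j k) ->
  (forall g, D g -> (w *m g) i k = g j k) ->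
  (forall g, D g -> (w *m g) j k = - g i k) ->
  forall g, D g -> exists s, [/\ short (C.+1 * (size (g i k) + 2 * size (g j k))) s,
    D (s *m g) & (s *m g) j k = 0].
Proof.
move=> hup hw Dup Dw upi upj wi wj g; move: {2}(size (g j k)) (leqnn (size (g j k))) => N.
elim: N g => [|N IH] g hN Dg.
  exists 1%:M; rewrite mul1mx; split=> //; first exact: short1.
  by apply/eqP; rewrite -size_poly_leq0.
have [b0|b0] := eqVneq (g j k) 0.
  by exists 1%:M; rewrite mul1mx; split=> //; apply: short1.
set a : pF := g i k; set b : pF := g j k in hN b0 *.
pose q := a %/ b; pose g1 := w *m (up (- q) *m g).
have D1 : D (up (- q) *m g) by apply: Dup.
have D2 : D g1 by apply: Dw.
have ei : g1 i k = b by rewrite /g1 wi ?upj.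
have ej : g1 j k = - (a %% b).
  rewrite /g1 wj // upi // -/a -/b {1}(divp_eq a b) -/q; ring.
have lt_r : (size (a %% b)%R < size b)%N by rewrite ltn_modp.
have [|s [hs Ds sj]] := IH g1 _ D2.
  by rewrite ej size_polyN -ltnS (leq_trans lt_r).
exists (s *m (w *m up (- q))); rewrite -!mulmxA; split=> //.
apply: (short_leq _ (shortM hs (shortM hw (hup _)))).
rewrite ei ej !size_polyN.
(* Here [y] is the size of the quotient plus one. The remainder being strictly smaller than [b], the
   potential drops by at least [y], which pays for the [1 + C * y] new letters. *)
have bound (x y t : nat) : (0 < y)%N -> (x + y <= t)%N -> (C.+1 * x + (1 + C * y) <= C.+1 * t)%N.
  move=> y0 h; apply: (@leq_trans (C.+1 * (x + y))); last by rewrite leq_mul2l h.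
  by rewrite mulnDr leq_add2l mulSn leq_add2r.
apply: bound => //.
have [lt_ab|le_ba] := ltnP (size a) (size b).
  rewrite /q divp_small // size_poly0 modp_small //; move: lt_ab; move: (size a) (size b) => x y; lia.
rewrite /q size_divp //.
have b1 : (0 < size b)%N by rewrite size_poly_gt0.
move: lt_r le_ba b1; move: (size a) (size b) (size (a %% b)) => x y t; lia.
Qed.

(** * Reduction of a symplectic matrix to the Heisenberg group *)

Definition linearly_short (D : 'M[pF]_4 -> Prop) :=
  exists C, forall g, inSp4 g -> D g -> short (C * msize g) g.

(** A multiplier [s] of length [O(msize g)] keeps [msize (s *m g)] linear in [msize g], so
    reductions compose. From the last lemma back to the first, they clear the entries [(3, 0)],
    [(2, 0)], [(1, 0)], normalise [(0, 0)], clear [(2, 1)], normalise [(1, 1)] and clear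
    [(1, 2)]. *)
Lemma linearly_short_reduce (D D' : 'M[pF]_4 -> Prop) :
  (exists K, forall g, inSp4 g -> D g ->
     exists s, [/\ short (K * msize g) s & D' (s *m g)]) ->
  linearly_short D' -> linearly_short D.
Proof.
move=> [K hK] [C hC]; exists (K + C * K.+1)%N => g hg Dg.
have [s [hs Ds]] := hK g hg Dg; have hs4 := short_inSp4 hs.
have g0 : (0 < msize g)%N by rewrite msize_gt0 ?inSp4_neq0.
suff : short ((K + C * K.+1) * msize g) (ginv s *m (s *m g)) by rewrite /ginv mulKmx ?inSp4_unit.
apply: (short_leq _ (shortM (shortV hs) (hC _ (inSp4M hs4 hg) Ds))).
rewrite mulnDl leq_add2l -mulnA leq_mul2l mulSn; apply/orP; right.
apply: (leq_trans (msizeM _ _)); have := short_msize hs; lia.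
Qed.

Lemma poly_unit_const (a b : pF) : a * b = 1 -> exists c : F, a = c%:P /\ c != 0.
Proof.
move=> h.
have : a \is a GRing.unit by apply/unitrPr; exists b.
rewrite poly_unitE => /andP[/eqP/eqP sa]; rewrite unitfE => c0.
by move: sa c0 => /size_poly1P [c c0 ->]; exists c.
Qed.

Lemma linearly_short_heis :
  linearly_short (fun g => exists u v z, g = heis u v z).
Proof.
(* [256 = 156 + 100], the additive constant being absorbed because [msize g] is at least 1. *)
exists 256 => g hg [u [v [z e]]].
have g0 : (0 < msize g)%N by rewrite msize_gt0 ?inSp4_neq0.
have hu : (size u <= msize g)%N by have := size_le_msize g 0 1; rewrite {1}e mxE.
have hv : (size v <= msize g)%N by have := size_le_msize g 0 2; rewrite {1}e mxE.
have hz : (size z <= msize g)%N by have := size_le_msize g 0 3; rewrite {1}e mxE.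
by rewrite {2}e; apply: (short_leq _ (short_heis hu hv hz)); lia.
Qed.

Definition fixes_e0 g := [/\ g 0 0 = 1, g 1 0 = 0, g 2 0 = 0 & g 3 0 = 0].

(** Once a shear has cleared entry [(1, 2)], the symplectic relations force the shape of [heis]. *)
Lemma linearly_short_unipotent :
  linearly_short (fun g => [/\ fixes_e0 g, g 1 1 = 1 & g 2 1 = 0]).
Proof.
apply: linearly_short_reduce linearly_short_heis; exists 24 => g hg [[g00 g10 g20 g30] g11 g21].
have g0 : (0 < msize g)%N by rewrite msize_gt0 ?inSp4_neq0.
exists (levi 1 (- g 1 2) 0 1); split.
  apply: (short_leq _ (short_levi_upper (_ : (_ <= msize g)%N))); first lia.
  by rewrite size_polyN size_le_msize.
exists (g 0 1), (g 0 2), (g 0 3); move: hg.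
rewrite (mx4_eta g) g00 g10 g20 g30 g11 g21 => /inSp4_mx4.
move: (g 0 1) (g 0 2) (g 0 3) (g 1 2) (g 1 3) (g 2 2) (g 2 3) (g 3 1) (g 3 2) (g 3 3).
move=> u v z a b c d x y t [[h1 h2 h3] [h4 h5 h6]].
have ex : x = 0 by rewrite -h1; ring.
have ey : y = 0 by rewrite -h2; ring.
have et : t = 1 by rewrite -h3; ring.
rewrite {}ex {}ey {}et in h1 h2 h3 h4 h5 h6 *.
have ec : c = 1 by rewrite -h4; ring.
rewrite {}ec in h1 h2 h3 h4 h5 h6 *.
have ed : d = - u by rewrite -[LHS]subr0 -h5; ring.
rewrite {}ed in h6 *.
have eb : b = v - a * u by rewrite -[LHS]add0r -h6; ring.
by rewrite eb !mxE /= mx4_mul; congr mx4; ring.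
Qed.

(** The relations give [g 1 1 * g 2 2 = 1], so [g 1 1] is a nonzero constant, which one diagonal
    letter normalises. *)
Lemma linearly_short_triangular :
  linearly_short (fun g => fixes_e0 g /\ g 2 1 = 0).
Proof.
apply: linearly_short_reduce linearly_short_unipotent; exists 1%N => g hg [[g00 g10 g20 g30] g21].
have g0 : (0 < msize g)%N by rewrite msize_gt0 ?inSp4_neq0.
have [c [ec c0]] : exists c : F, g 1 1 = c%:P /\ c != 0.
  apply: (@poly_unit_const _ (g 2 2)); move: hg.
  rewrite {1}(mx4_eta g) g00 g10 g20 g30 g21 => /inSp4_mx4 [[h1 h2 h3] [h4 h5 h6]].
  have e1 : g 3 1 = 0 by rewrite -h1; ring.
  have e2 : g 3 2 = 0 by rewrite -h2; ring.
  by rewrite -h4 e1 e2; ring.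
exists (levi c^-1%:P 0%:P 0%:P c%:P); split.
  apply: (short_leq (_ : (1 <= _)%N)); first by rewrite mul1n.
  by apply: levi_const_short; rewrite mulVf // mulr0 subr0.
have ecc : c^-1%:P * c%:P = 1 :> pF by rewrite -polyCM mulVf.
rewrite (mx4_eta g) g00 g10 g20 g30 g21 ec mx4_mul /fixes_e0 !mxE /=.
by split; first split; rewrite ?polyC0; try ring; rewrite -ecc; ring.
Qed.

Lemma linearly_short_fixes_e0 : linearly_short fixes_e0.
Proof.
(* [75 = 25 * 3]: [euclid_column] with [C = 24] costs 25 times a potential of at most [3 * msize g].
   The constants 471 and 39 below arise in the same way from 156 and 12. *)
apply: linearly_short_reduce linearly_short_triangular; exists 75 => g hg Dg.
have g0 : (0 < msize g)%N by rewrite msize_gt0 ?inSp4_neq0.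
pose w : 'M[pF]_4 := levi 0 1 (-1) 0.
have hw : short 1 w.
  by have := @levi_const_short 0 1 (-1) 0; rewrite polyCN polyC0 polyC1; apply; ring.
have act (a b c d : pF) h : fixes_e0 h ->
    [/\ fixes_e0 (levi a b c d *m h), (levi a b c d *m h) 1 1 = a * h 1 1 + b * h 2 1 &
        (levi a b c d *m h) 2 1 = c * h 1 1 + d * h 2 1].
  move=> [h0 h1 h2 h3]; rewrite /fixes_e0 !mulmx4E h0 h1 h2 h3 !mxE /=.
  by split; first split; ring.
have [P||P h /(act 1 P 0 1) []|h /(act 0 1 (-1) 0) []|P h /(act 1 P 0 1) [_ -> _]
     |P h /(act 1 P 0 1) [_ _ ->]|h /(act 0 1 (-1) 0) [_ -> _]|h /(act 0 1 (-1) 0) [_ _ ->]||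
     s [hs Ds sj]] // := @euclid_column (fun P => levi 1 P 0 1) w 1 2 1 fixes_e0 24 _ _ _ _ _ _ _ _ g.
- apply: (short_leq _ (short_levi_upper (leqnn _))); lia.
- ring.
- ring.
- ring.
- ring.
exists s; split=> //; apply: (short_leq _ hs).
have := size_le_msize g 1 1; have := size_le_msize g 2 1; lia.
Qed.

(** Here [g 0 0 * g 3 3 = 1], so a constant diagonal matrix suffices. *)
Lemma linearly_short_eigen_e0 :
  linearly_short (fun g => [/\ g 1 0 = 0, g 2 0 = 0 & g 3 0 = 0]).
Proof.
apply: linearly_short_reduce linearly_short_fixes_e0; exists 1%N => g hg [g10 g20 g30].
have g0 : (0 < msize g)%N by rewrite msize_gt0 ?inSp4_neq0.
have [c [ec c0]] : exists c : F, g 0 0 = c%:P /\ c != 0.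
  apply: (@poly_unit_const _ (g 3 3)); move: hg.
  rewrite {1}(mx4_eta g) g10 g20 g30 => /inSp4_mx4 [[h1 h2 h3] [h4 h5 h6]].
  by rewrite -h3; ring.
have ecc : c^-1%:P * c%:P = 1 :> pF by rewrite -polyCM mulVf.
exists (mx4 c^-1%:P 0 0 0 0 1 0 0 0 0 1 0 0 0 0 c%:P); split.
  apply: (short_leq (_ : (1 <= _)%N)); first by rewrite mul1n.
  apply: short_gen; first by apply/inSp4_mx4; split; split; try ring; rewrite -[RHS]ecc; ring.
  apply: msize_mx4; rewrite /= !size_poly0 size_poly1 /=.
  by rewrite !(leq_trans (size_polyC_leq1 _)).
rewrite /fixes_e0 !mulmx4E ec g10 g20 g30 !mxE /=.
by split; try ring; rewrite -[RHS]ecc; ring.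
Qed.

(** Besides row 0, [heis P 0 0] changes row 2 by a multiple of row 3; column 0 does not see this,
    its last two entries being zero. *)
Lemma linearly_short_span_e0_e1 : linearly_short (fun g => g 2 0 = 0 /\ g 3 0 = 0).
Proof.
apply: linearly_short_reduce linearly_short_eigen_e0; exists 471 => g hg Dg.
pose w : 'M[pF]_4 := mx4 0 1 0 0 (-1) 0 0 0 0 0 0 (-1) 0 0 1 0.
have hw : short 1 w.
  apply: short_gen; first by apply/inSp4_mx4; split; split; ring.
  by apply: msize_mx4; rewrite /= size_polyN size_poly0 size_poly1.
have [P||P h|h|P h|P h|h|h||s [hs [s2 s3] s1]] // :=
  @euclid_column (fun P => heis P 0 0) w 0 1 0 (fun g => g 2 0 = 0 /\ g 3 0 = 0) 156 _ _ _ _ _ _ _ _ g.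
- by apply: (short_leq _ (@short_heis (size P) _ _ _ _ _ _)); rewrite ?size_poly0 //; lia.
- by move=> [h2 h3]; rewrite !mulmx4E h2 h3 !mxE /=; split; ring.
- by move=> [h2 h3]; rewrite !mulmx4E h2 h3 !mxE /=; split; ring.
- by move=> [h2 h3]; rewrite !mulmx4E h2 h3 !mxE /=; ring.
- by move=> [h2 h3]; rewrite !mulmx4E h2 h3 !mxE /=; ring.
- by move=> [h2 h3]; rewrite !mulmx4E h2 h3 !mxE /=; ring.
- by move=> [h2 h3]; rewrite !mulmx4E h2 h3 !mxE /=; ring.
exists s; split=> //; apply: (short_leq _ hs).
have := size_le_msize g 0 0; have := size_le_msize g 1 0; lia.
Qed.

Lemma linearly_short_perp_e0 : linearly_short (fun g => g 3 0 = 0).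
Proof.
apply: linearly_short_reduce linearly_short_span_e0_e1; exists 75 => g hg Dg.
pose w : 'M[pF]_4 := levi 0 1 (-1) 0.
have hw : short 1 w.
  by have := @levi_const_short 0 1 (-1) 0; rewrite polyCN polyC0 polyC1; apply; ring.
have [P||P h|h|P h|P h|h|h||s [hs s3 s2]] // :=
  @euclid_column (fun P => levi 1 P 0 1) w 1 2 0 (fun g => g 3 0 = 0) 24 _ _ _ _ _ _ _ _ g.
- apply: (short_leq _ (short_levi_upper (leqnn _))); lia.
- by move=> h3; rewrite !mulmx4E h3 !mxE /=; ring.
- by move=> h3; rewrite !mulmx4E h3 !mxE /=; ring.
- by move=> h3; rewrite !mulmx4E h3 !mxE /=; ring.
- by move=> h3; rewrite !mulmx4E h3 !mxE /=; ring.
- by move=> h3; rewrite !mulmx4E h3 !mxE /=; ring.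
- by move=> h3; rewrite !mulmx4E h3 !mxE /=; ring.
exists s; split=> //; apply: (short_leq _ hs).
have := size_le_msize g 1 0; have := size_le_msize g 2 0; lia.
Qed.

Theorem word_length_le_msize : exists C, forall g, inSp4 g -> short (C * msize g) g.
Proof.
suff [C hC] : linearly_short (fun=> True) by exists C => g hg; apply: hC.
apply: linearly_short_reduce linearly_short_perp_e0; exists 39 => g hg _.
pose w : 'M[pF]_4 := mx4 0 0 0 1 0 1 0 0 0 0 1 0 (-1) 0 0 0.
have hw : short 1 w.
  apply: short_gen; first by apply/inSp4_mx4; split; split; ring.
  by apply: msize_mx4; rewrite /= size_polyN size_poly0 size_poly1.
have [P||P h|h|P h|P h|h|h||s [hs _ s3]] // :=
  @euclid_column (fun P => heis 0 0 P) w 0 3 0 (fun=> True) 12 _ _ _ _ _ _ _ _ g.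
- apply: (short_leq _ (short_center (leqnn _))); lia.
- by move=> _; rewrite !mulmx4E !mxE /=; ring.
- by move=> _; rewrite !mulmx4E !mxE /=; ring.
- by move=> _; rewrite !mulmx4E !mxE /=; ring.
- by move=> _; rewrite !mulmx4E !mxE /=; ring.
exists s; split=> //; apply: (short_leq _ hs).
have := size_le_msize g 0 0; have := size_le_msize g 3 0; lia.
Qed.
End WordLength.

(** * Schatten norms of finitely supported matrices *)

Section ComplexModulus.
Variable R : realType.
Implicit Types z w : R[i].

Lemma cmodE z : `|z| = (cmod z)%:C%C.
Proof. by []. Qed.

Lemma cmod_ge0 z : 0 <= cmod z.
Proof. by case: z => a b; rewrite sqrtr_ge0. Qed.

Lemma cmod0 : cmod (0 : R[i]) = 0.
Proof. exact: ComplexField.Normc.normc0. Qed.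

Lemma cmodM z w : cmod (z * w) = cmod z * cmod w.
Proof. exact: ComplexField.Normc.normcM. Qed.

Lemma cmodD z w : cmod (z + w) <= cmod z + cmod w.
Proof. exact: le_normcD. Qed.

Lemma cmodN z : cmod (- z) = cmod z.
Proof. exact: normcN. Qed.

Lemma cmod_real (a : R) : cmod a%:C%C = `|a|.
Proof. by rewrite /cmod /= expr0n addr0 sqrtr_sqr. Qed.

Lemma cmod_conj z : cmod (Num.conj z) = cmod z.
Proof. by apply: (@complexI R); rewrite -!cmodE norm_conjC. Qed.

Lemma cmod_sqr z : ((cmod z) ^+ 2)%:C%C = z * Num.conj z.
Proof. by rewrite rmorphXn /= -cmodE normCK. Qed.

Lemma cmod_sum (I : Type) (r : seq I) (P : pred I) (f : I -> R[i]) :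
  cmod (\sum_(i <- r | P i) f i) <= \sum_(i <- r | P i) cmod (f i).
Proof.
elim/big_ind2: _ => [|a b c d h1 h2|//]; first by rewrite cmod0.
exact: le_trans (cmodD _ _) (lerD h1 h2).
Qed.

End ComplexModulus.

Section FiniteSchurTest.
Variables (R : realType) (I J : finType).

(** The Schur test for the Gram matrix [A A^*], whose row sums are at most [b ^ 2], bounds its norm
    by [b ^ 2], hence that of [A] by [b]. *)
Lemma schur_test (A : I -> J -> R[i]) (eta : I -> R[i]) (xi : J -> R[i]) (b : R) :
  0 < b ->
  (forall i, \sum_i' cmod (\sum_j A i j * Num.conj (A i' j)) <= b ^+ 2) ->
  \sum_i cmod (eta i) ^+ 2 <= 1 -> \sum_j cmod (xi j) ^+ 2 <= 1 ->
  cmod (\sum_i \sum_j Num.conj (eta i) * A i j * xi j) <= b.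
Proof.
move=> b0 hA heta hxi.
pose B i i' := \sum_j A i j * Num.conj (A i' j).
have BC i i' : cmod (B i' i) = cmod (B i i').
  rewrite -cmod_conj /B rmorph_sum /=; congr cmod; apply: eq_bigr => j _.
  by rewrite rmorphM /= conjCK mulrC.
pose zeta j := \sum_i Num.conj (eta i) * A i j.
have hzeta : \sum_j cmod (zeta j) ^+ 2 <= b ^+ 2.
  have e : (\sum_j cmod (zeta j) ^+ 2)%:C%C =
           \sum_i \sum_i' Num.conj (eta i) * eta i' * B i i'.
    rewrite rmorph_sum /=; under eq_bigr => j _.
      rewrite cmod_sqr /zeta rmorph_sum mulr_suml /=.
      under eq_bigr => i _ do rewrite mulr_sumr.
      over.
    rewrite exchange_big /=; apply: eq_bigr => i _.
    rewrite exchange_big /=; apply: eq_bigr => i' _.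
    rewrite mulr_sumr; apply: eq_bigr => j _.
    by rewrite rmorphM /= conjCK; ring.
  have -> : \sum_j cmod (zeta j) ^+ 2 = cmod (\sum_i \sum_i' Num.conj (eta i) * eta i' * B i i').
    by rewrite -e cmod_real ger0_norm // sumr_ge0 // => j _; rewrite sqr_ge0.
  apply: le_trans (cmod_sum _ _ _) _.
  (* Arithmetic-geometric mean on [|eta i| |eta i'|]; as [|B i i'|] is symmetric, the two halves
     have equal sums. *)
  apply: (@le_trans _ _ (\sum_i \sum_i' (cmod (eta i) ^+ 2 * cmod (B i i') / 2 +
                                         cmod (eta i') ^+ 2 * cmod (B i' i) / 2))).
    apply: ler_sum => i _; apply: le_trans (cmod_sum _ _ _) _.
    apply: ler_sum => i' _; rewrite !cmodM cmod_conj (BC i i').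
    have := sqr_ge0 (cmod (eta i) - cmod (eta i')); have := cmod_ge0 (B i i').
    nra.
  under eq_bigr => i _ do rewrite big_split /=.
  rewrite big_split /= [X in _ + X <= _]exchange_big /= -mulr2n.
  have -> : \sum_i \sum_i' cmod (eta i) ^+ 2 * cmod (B i i') / 2 =
            (\sum_i cmod (eta i) ^+ 2 * \sum_i' cmod (B i i')) / 2.
    by rewrite mulr_suml; apply: eq_bigr => i _; rewrite mulr_sumr mulr_suml.
  rewrite -[leLHS]mulr_natr divfK ?pnatr_eq0 //.
  apply: (@le_trans _ _ (\sum_i cmod (eta i) ^+ 2 * b ^+ 2)).
    by apply: ler_sum => i _; apply: ler_wpM2l; [exact: sqr_ge0|exact: hA].
  by rewrite -mulr_suml ler_piMl ?sqr_ge0.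
have -> : \sum_i \sum_j Num.conj (eta i) * A i j * xi j = \sum_j zeta j * xi j.
  by rewrite exchange_big /=; apply: eq_bigr => j _; rewrite mulr_suml.
apply: le_trans (cmod_sum _ _ _) _.
(* The arithmetic-geometric mean with weight [b] replaces Cauchy-Schwarz; each half contributes
   [b / 2]. *)
apply: (@le_trans _ _ (\sum_j (cmod (zeta j) ^+ 2 / (2 * b) + b / 2 * cmod (xi j) ^+ 2))).
  apply: ler_sum => j _; rewrite cmodM -subr_ge0.
  have -> : cmod (zeta j) ^+ 2 / (2 * b) + b / 2 * cmod (xi j) ^+ 2 - cmod (zeta j) * cmod (xi j)
     = (cmod (zeta j) - b * cmod (xi j)) ^+ 2 / (2 * b) by field; lra.
  by rewrite divr_ge0 ?sqr_ge0 //; lra.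
rewrite big_split /= -mulr_suml -mulr_sumr.
apply: (@le_trans _ _ (b ^+ 2 / (2 * b) + b / 2 * 1)).
  apply: lerD; first by rewrite ler_pM2r ?invr_gt0 //; lra.
  by rewrite ler_pM2l //; lra.
by rewrite le_eqVlt; apply/orP; left; apply/eqP; field; lra.
Qed.

End FiniteSchurTest.

Section KernelMatrix.
Variables (R : realType) (X : eqType) (D : pred X) (I J : finType).
Variables (g : I -> X) (h : J -> X).
Hypotheses (g_inj : injective g) (h_inj : injective h).
Hypotheses (Dg : forall i, D (g i)) (Dh : forall j, D (h j)).
Implicit Types (A : I -> J -> R[i]) (s : seq X).

(** The push-forward of [A] along [g] and [h], extended by zero; summing over indices avoids
    choosing preimages. *)
Definition kernel_mx A (x y : X) : R[i] :=
  \sum_i \sum_j (x == g i)%:R * (y == h j)%:R * A i j.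

Lemma sum_eq_seq s (a : X) (f : X -> R[i]) : uniq s ->
  \sum_(x <- s) (x == a)%:R * f x = (a \in s)%:R * f a.
Proof.
move=> us; have [as_|as_] := boolP (a \in s).
  rewrite (bigD1_seq a) //= eqxx big1 ?addr0 // => x /negPf ->; exact: mul0r.
rewrite mul0r big_seq big1 // => x xs.
by case: eqP => [e|_]; rewrite ?mul0r // -e xs in as_ *.
Qed.

Lemma bform_kernel A s (xi eta : X -> R[i]) : uniq s ->
  bform (kernel_mx A) s xi eta =
  \sum_i \sum_j Num.conj ((g i \in s)%:R * eta (g i)) * A i j * ((h j \in s)%:R * xi (h j)).
Proof.
move=> us; rewrite /bform.
under [RHS]eq_bigr => i _.
  under eq_bigr => j _.
    rewrite rmorphM /= conjC_nat -(sum_eq_seq (g i) (fun x => Num.conj (eta x)) us).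
    rewrite -(sum_eq_seq (h j) xi us) !mulr_suml.
    under eq_bigr => x _ do rewrite mulr_sumr.
    over.
  rewrite exchange_big /=.
  under eq_bigr => x _ do rewrite exchange_big /=.
  over.
rewrite /= [RHS]exchange_big /=; apply: eq_bigr => x _.
rewrite [RHS]exchange_big /=; apply: eq_bigr => y _.
rewrite mulr_sumr mulr_suml; apply: eq_bigr => i _.
rewrite mulr_sumr mulr_suml; apply: eq_bigr => j _; ring.
Qed.

Lemma sum_inj_le (K : finType) (f : K -> X) s (phi : X -> R) : injective f -> uniq s ->
  (forall x, 0 <= phi x) ->
  \sum_k (f k \in s)%:R * phi (f k) <= \sum_(x <- s) phi x.
Proof.
move=> f_inj us phi0.
rewrite -[leLHS]big_enum /= (eq_bigr (fun k => if f k \in s then phi (f k) else 0)); last first.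
  by move=> k _; case: (f k \in s); rewrite ?mul1r ?mul0r.
rewrite -big_mkcond /= -big_filter -(big_map f xpredT phi).
set t := map f _.
have ut : uniq t by rewrite map_inj_uniq // filter_uniq // enum_uniq.
have ts : {subset t <= s} by move=> x /mapP[k]; rewrite mem_filter => /andP[ks _] ->.
have pt : perm_eq t [seq x <- s | x \in t].
  apply: uniq_perm => //; first exact: filter_uniq.
  by move=> x; rewrite mem_filter; case: (boolP (x \in t)) => //= /ts ->.
rewrite (perm_big _ pt) /= big_filter big_mkcond /=.
by apply: ler_sum => x _; case: ifP.
Qed.

Lemma l2n_le1 s (xi : X -> R[i]) :
  l2n s xi <= 1 -> \sum_(x <- s) cmod (xi x) ^+ 2 <= 1.
Proof.
rewrite /l2n => hs; rewrite -[leLHS]sqr_sqrtr; last by rewrite sumr_ge0 // => x _; exact: sqr_ge0.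
by rewrite -[leRHS](expr1n _ 2) ler_pXn2r // nnegrE ?sqrtr_ge0.
Qed.

Lemma opnorm_kernel_le A (b : R) : 0 < b ->
  (forall i, \sum_i' cmod (\sum_j A i j * Num.conj (A i' j)) <= b ^+ 2) ->
  (opnorm D (kernel_mx A) <= b%:E)%E.
Proof.
move=> b0 hA; apply: ge_ereal_sup => _ [s [xi [eta [/andP[us _] hxi heta ->]]]].
rewrite lee_fin bform_kernel //; apply: (schur_test b0 hA).
  apply: le_trans (l2n_le1 heta).
  apply: le_trans (sum_inj_le g_inj us (fun x => sqr_ge0 (cmod (eta x)))).
  apply: ler_sum => i _; rewrite cmodM exprMn; case: (g i \in s).
    by rewrite [cmod _](ComplexField.Normc.normc1 R) expr1n.
  by rewrite cmod0 expr0n !mul0r.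
apply: le_trans (l2n_le1 hxi).
apply: le_trans (sum_inj_le h_inj us (fun x => sqr_ge0 (cmod (xi x)))).
apply: ler_sum => i _; rewrite cmodM exprMn; case: (h i \in s).
  by rewrite [cmod _](ComplexField.Normc.normc1 R) expr1n.
by rewrite cmod0 expr0n !mul0r.
Qed.

(** Tested on the constant vectors [N ^ (-1/2)] carried by the images of [g] and [h]. *)
Lemma opnorm_kernel_ge A (N : nat) : (0 < N)%N -> #|I| = N -> #|J| = N ->
  ((cmod (\sum_i \sum_j A i j) / N%:R)%:E <= opnorm D (kernel_mx A))%E.
Proof.
move=> N0 cI cJ; apply: ereal_sup_ubound.
have N0' : 0 < N%:R :> R by rewrite ltr0n.
pose c : R := Num.sqrt N%:R^-1.
have c2 : c * c = N%:R^-1 by rewrite -expr2 sqr_sqrtr ?invr_ge0 ?ltW.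
pose s := undup (codom g ++ codom h).
have gs i : g i \in s by rewrite mem_undup mem_cat codom_f.
have hs j : h j \in s by rewrite mem_undup mem_cat codom_f orbT.
have us : uniq s by apply: undup_uniq.
have l2 (K : finType) (f : K -> X) : injective f -> #|K| = N ->
    l2n s (fun x => if x \in codom f then c%:C%C else 0) <= 1.
  move=> f_inj cK; rewrite /l2n -[leRHS]sqrtr1 ler_wsqrtr //.
  rewrite (eq_bigr (fun x => if x \in codom f then N%:R^-1 else 0)); last first.
    move=> x _; case: ifP => _; last by rewrite cmod0 expr0n.
    by rewrite cmod_real ger0_norm ?sqrtr_ge0 // expr2.
  rewrite -big_mkcond /= -big_filter big_const_seq count_predT iter_addr_0 -[leLHS]mulr_natl.
  rewrite ler_pdivrMr // mul1r ler_nat.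
  rewrite -[leqRHS]cK -(size_codom f); apply: uniq_leq_size; first exact: filter_uniq.
  by move=> x; rewrite mem_filter => /andP[].
exists s, (fun x => if x \in codom h then c%:C%C else 0), (fun x => if x \in codom g then c%:C%C else 0).
split; [|exact: l2|exact: l2|].
  rewrite /finsub us /=; apply/allP => x; rewrite mem_undup mem_cat.
  by case/orP => /codomP[i ->].
rewrite bform_kernel //; congr (_%:E).
under [in RHS]eq_bigr => i _.
  under eq_bigr => j _.
    rewrite gs hs !codom_f !mul1r.
    have -> : Num.conj (c%:C%C : R[i]) = c%:C%C by apply: conj_Creal; rewrite complex_real.
    rewrite mulrC mulrA -rmorphM /= c2.
    over.
  rewrite -mulr_sumr.
  over.
rewrite -mulr_sumr cmodM cmod_real ger0_norm ?invr_ge0 ?ltW //; exact: mulrC.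
Qed.

Lemma kernel_mx_row A (x y : X) : x \notin codom g -> kernel_mx A x y = 0.
Proof.
move=> hx; rewrite /kernel_mx big1 // => i _; rewrite big1 // => j _.
have /negPf -> : x != g i by apply: contraNneq hx => ->; apply: codom_f.
by rewrite !mul0r.
Qed.

End KernelMatrix.

(** * Approximation numbers and Schatten norms *)

Section SchattenNorm.
Variables (R : realType) (X : eqType) (D : pred X).
Implicit Types (T : X -> X -> R[i]) (p b : R).
Local Open Scope ereal_scope.

Lemma opnorm_ext T T' : (forall x y, D x -> D y -> T x y = T' x y) ->
  opnorm D T = opnorm D T'.
Proof.
move=> e; rewrite /opnorm; congr ereal_sup; apply/seteqP.
have bE (U U' : X -> X -> R[i]) s xi eta : (forall x y, D x -> D y -> U x y = U' x y) ->
    finsub D s -> bform U s xi eta = bform U' s xi eta.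
  move=> eU /andP[_ /allP hs]; apply: eq_big_seq => x xs; apply: eq_big_seq => y ys.
  by rewrite eU ?hs.
split=> _ [s [xi [eta [hs h1 h2 ->]]]]; exists s, xi, eta; split=> //; congr (cmod _)%:E;
  by apply: bE => // x y Dx Dy; rewrite e.
Qed.

Lemma opnorm_ge0 T : 0 <= opnorm D T.
Proof.
apply: ereal_sup_ubound; exists [::], (fun=> 0%R), (fun=> 0%R).
by rewrite /finsub /l2n /bform !big_nil sqrtr0 cmod0; split.
Qed.

Lemma opnorm0 : opnorm D (fun _ _ => 0%R : R[i]) = 0.
Proof.
apply/eqP; rewrite eq_le opnorm_ge0 andbT; apply: ge_ereal_sup => _ [s [xi [eta [_ _ _ ->]]]].
rewrite lee_fin /bform big1 ?cmod0 // => x _; rewrite big1 // => y _.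
by rewrite mulr0 mul0r.
Qed.

Lemma sing_ge0 T n : 0 <= sing D T n.
Proof. by apply: le_ereal_inf_tmp => _ [Rm _ <-]; apply: opnorm_ge0. Qed.

Lemma sing0E T : sing D T 0 = opnorm D T.
Proof.
apply/eqP; rewrite eq_le; apply/andP; split.
  apply: ereal_inf_lbound; exists (fun _ _ => 0%R); last by apply: opnorm_ext => x y _ _; rewrite subr0.
  by exists (fun _ _ => 0%R), (fun _ _ => 0%R) => x y _ _; rewrite big_ord0.
apply: le_ereal_inf_tmp => _ [Rm [u [v hR]] <-].
rewrite (@opnorm_ext T (fun x y => T x y - Rm x y)%R) // => x y Dx Dy.
by rewrite hR // big_ord0 subr0.
Qed.

Lemma sing_le_opnorm T n : sing D T n <= opnorm D T.
Proof.
apply: ereal_inf_lbound; exists (fun _ _ => 0%R); last by apply: opnorm_ext => x y _ _; rewrite subr0.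
exists (fun _ _ => 0%R), (fun _ _ => 0%R) => x y _ _.
by rewrite big1 // => i _; rewrite mul0r.
Qed.

Lemma sing_eq0 T (r : seq X) n : (forall x y, x \notin r -> T x y = 0%R) ->
  (size r <= n)%N -> sing D T n = 0.
Proof.
move=> hT rn; apply/eqP; rewrite eq_le sing_ge0 andbT -opnorm0.
apply: ereal_inf_lbound; exists T; last by apply: opnorm_ext => x y _ _; rewrite subrr.
(* Decomposition of [T] into rows; [index] selects one occurrence if [r] has repetitions. The
   default [y] is reached only for [i >= size r], where the first factor vanishes. *)
exists (fun i x => ((x \in r) && (index x r == i :> nat))%:R%R), (fun i y => T (nth y r i) y).
move=> x y _ _; have [xr|xr] := boolP (x \in r); last first.
  by rewrite hT // big1 // => i _; rewrite mul0r.
have hi : (index x r < n)%N by apply: leq_trans rn; rewrite index_mem.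
rewrite (bigD1 (Ordinal hi)) //= eqxx mul1r nth_index // big1 ?addr0 // => i.
rewrite -val_eqE /= eq_sym => /negPf ->; exact: mul0r.
Qed.

Lemma le_poweR p (x y : \bar R) : (0 <= p)%R -> 0 <= x -> x <= y -> x `^ p <= y `^ p.
Proof.
move=> p0 x0 xy; apply: gt0_ler_poweR => //; rewrite in_itv /= leey andbT //.
exact: le_trans xy.
Qed.

Lemma opnorm_le_spnorm p T : (0 < p)%R -> opnorm D T <= spnorm D p T.
Proof.
move=> p0; have -> : opnorm D T = (opnorm D T `^ p) `^ p^-1%R.
  by rewrite -poweRrM mulfV ?gt_eqF // poweRe1 // opnorm_ge0.
apply: le_poweR; [by rewrite invr_ge0 ltW|exact: poweR_ge0|].
apply: ereal_sup_ubound; exists 1%N => //.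
by rewrite big_ord_recl big_ord0 adde0 sing0E.
Qed.

(** The rank is at most [size r], so at most that many singular values are nonzero, each at most
    [b]. *)
Lemma spnorm_le p T (r : seq X) b : (0 < p)%R -> (0 <= b)%R ->
  (forall x y, x \notin r -> T x y = 0%R) -> opnorm D T <= b%:E ->
  spnorm D p T <= ((size r)%:R `^ p^-1 * b)%:E.
Proof.
move=> p0 b0 hT hb.
have -> : ((size r)%:R `^ p^-1 * b)%:E = (((size r)%:R * b `^ p)%:E `^ p^-1%R) :> \bar R.
  rewrite poweR_EFin powRM ?powR_ge0 // -powRrM mulfV ?gt_eqF // powRr1 //.
apply: le_poweR; first by rewrite invr_ge0 ltW.
  by apply: ereal_sup_ubound; exists 0%N => //; rewrite big_ord0.
apply: ge_ereal_sup => _ [N _ <-].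
apply: (@le_trans _ _ (\sum_(n < N) (if (n < size r)%N then (b `^ p)%:E else 0))).
  apply: lee_sum => n _; case: ltnP => hn.
    rewrite -poweR_EFin; apply: le_poweR; [exact: ltW|exact: sing_ge0|].
    exact: le_trans (sing_le_opnorm _ _) hb.
  by rewrite (sing_eq0 hT hn) poweR0r // gt_eqF.
rewrite -big_mkcond /= sumEFin lee_fin big_const iter_addr_0 -[leLHS]mulr_natl.
rewrite ler_wpM2r ?powR_ge0 // ler_nat -sum1_card big_mkcond /=.
have -> : (\sum_(i < N) (if (i < size r)%N then 1 else 0) = minn N (size r))%N.
  elim: N => [|N IH]; first by rewrite big_ord0 min0n.
  rewrite big_ord_recr /= IH; case: ltnP; lia.
exact: geq_minr.
Qed.
End SchattenNorm.

(** * The point-line test matrix *)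

Section IncidenceKernel.
Variables (F : finFieldType) (R : realType) (n : nat).
Local Notation V := 'rV[F]_n.+1.
Local Notation q := (#|F|%:R : R).
Implicit Types (u v x y a b : V).

(** Rows stand for polynomials of degree at most [n]. The product has degree at most [2 * n], so its
    coefficients from [n] on fit exactly in a row. *)
Definition trunc_mul x a : V := poly_rV (drop_poly n (rVpoly x * rVpoly a)).

Lemma trunc_mulDl u v a : trunc_mul (u + v) a = trunc_mul u a + trunc_mul v a.
Proof. by rewrite /trunc_mul linearD /= mulrDl drop_polyD linearD. Qed.

Lemma trunc_mulDr u v a : trunc_mul a (u + v) = trunc_mul a u + trunc_mul a v.
Proof. by rewrite /trunc_mul linearD /= mulrDr drop_polyD linearD. Qed.

Lemma trunc_mulBl u v a : trunc_mul (u - v) a = trunc_mul u a - trunc_mul v a.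
Proof. by apply/eqP; rewrite eq_sym subr_eq -trunc_mulDl subrK. Qed.

Lemma trunc_mulZr (c : F) a u : trunc_mul a (c *: u) = c *: trunc_mul a u.
Proof. by rewrite /trunc_mul linearZ /= -scalerAr drop_polyZ linearZ. Qed.

Definition const_row : V := poly_rV 1.

(** A monomial multiple moves the leading term of [u] to ['X^n], leaving only lower terms, which
    truncation removes. *)
Lemma trunc_mul_const u : u != 0 -> exists a, trunc_mul u a = const_row.
Proof.
move=> u0; set p := rVpoly u.
have p0 : p != 0 by apply: contraNneq u0 => e; rewrite -[u]rVpolyK -/p e linear0.
have sp : (size p <= n.+1)%N by apply: size_poly.
have sp0 : (0 < size p)%N by rewrite size_poly_gt0.
exists (poly_rV ((lead_coef p)^-1 *: 'X^(n - (size p).-1))).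
rewrite /trunc_mul poly_rV_K; last first.
  by rewrite (leq_trans (size_scale_leq _ _)) // size_polyXn; lia.
congr poly_rV; apply/polyP => i.
rewrite coef_drop_poly -scalerAr coefZ coefMXn ifF; last by lia.
have -> : (i + n - (n - (size p).-1) = i + (size p).-1)%N by lia.
rewrite coef1; case: i => [|i] /=; first by rewrite mulVf // lead_coef_eq0.
by rewrite -/p nth_default ?mulr0 //; move: sp0; move: (size p) => k; lia.
Qed.

Definition alpha v : R := (v == 0)%:R - (v == const_row)%:R.

Lemma sum_indicator (T : finType) (t : T) : \sum_x (x == t)%:R = 1 :> R.
Proof. by rewrite (bigD1 t) //= eqxx big1 ?addr0 // => x /negPf ->. Qed.

Lemma sum_norm_alpha : \sum_v `|alpha v| <= 2.
Proof.
apply: (@le_trans _ _ (\sum_v ((v == 0)%:R + (v == const_row)%:R))).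
  by apply: ler_sum => v _; apply: le_trans (ler_normB _ _) _; rewrite !normr_nat.
by rewrite big_split /= !sum_indicator.
Qed.

(** The translation of [t] by 1 matches the hits of [const_row] with the hits of 0. *)
Lemma sum_alpha_line v : \sum_(t : F) alpha (v + t *: const_row) = 0.
Proof.
have e : \sum_(t : F) (v + t *: const_row == const_row)%:R =
          \sum_(t : F) (v + t *: const_row == 0)%:R :> R.
  rewrite (reindex_inj (addIr 1)) /=; apply: eq_bigr => t _.
  by congr (_%:R); rewrite scalerDl scale1r addrA -subr_eq0 addrK.
by rewrite sumrB e subrr.
Qed.

Lemma q_gt1 : 1 < q.
Proof.
rewrite (ltr_nat _ 1) (cardD1 0) (cardD1 1) !inE oner_neq0 //.
Qed.

Lemma q_gt0 : 0 < q.
Proof. exact: lt_trans q_gt1. Qed.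

(** Moving [a] by [t *: a0], with [trunc_mul u a0 = const_row], does not change the sum; averaging
    over [t] gives zero by [sum_alpha_line]. *)
Lemma sum_alpha_trunc_mul u v : u != 0 -> \sum_a alpha (v + trunc_mul u a) = 0.
Proof.
move=> /trunc_mul_const [a0 ha0]; set S := LHS.
have e (t : F) : S = \sum_a alpha (v + trunc_mul u a + t *: const_row).
  rewrite /S (reindex_inj (addIr (t *: a0))) /=; apply: eq_bigr => a _.
  by rewrite trunc_mulDr trunc_mulZr ha0 addrA.
have : \sum_(t : F) S = 0.
  rewrite (eq_bigr _ (fun t _ => e t)) exchange_big big1 // => a _.
  exact: sum_alpha_line.
rewrite sumr_const -mulr_natr => /eqP; rewrite mulf_eq0 => /orP[/eqP //|].
by rewrite (gt_eqF q_gt0).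
Qed.

Definition incidence (i j : V * V) : V := j.2 - i.2 - trunc_mul i.1 j.1.

Definition incidence_kernel (i j : V * V) : R := alpha (incidence i j) / q ^+ n.+1.

(** For fixed [a], the value [c = incidence i (a, b)] replaces [b] as summation variable. *)
Lemma gram_incidence (i i' : V * V) :
  \sum_j incidence_kernel i j * incidence_kernel i' j =
  (\sum_c alpha c * \sum_a alpha (c + (i.2 - i'.2) + trunc_mul (i.1 - i'.1) a)) / (q ^+ n.+1) ^+ 2.
Proof.
rewrite -(pair_bigA _ (fun a b => incidence_kernel i (a, b) * incidence_kernel i' (a, b))) /=.
rewrite mulr_suml.
under [RHS]eq_bigr => c _ do rewrite mulr_sumr mulr_suml.
rewrite [RHS]exchange_big /=; apply: eq_bigr => a _.
rewrite (reindex_inj (addIr (i.2 + trunc_mul i.1 a))) /=; apply: eq_bigr => c _.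
rewrite /incidence_kernel /incidence /= trunc_mulBl.
have -> : c + (i.2 + trunc_mul i.1 a) - i.2 - trunc_mul i.1 a = c.
  by rewrite addrA addrAC addrK addrK.
have -> : c + (i.2 + trunc_mul i.1 a) - i'.2 - trunc_mul i'.1 a =
   c + (i.2 - i'.2) + (trunc_mul i.1 a - trunc_mul i'.1 a).
  by rewrite -!addrA; do 2!congr (_ + _); rewrite addrCA.
by rewrite expr2 invfM; ring.
Qed.

Lemma card_V : #|{: V}|%:R = q ^+ n.+1.
Proof. by rewrite card_mx mul1n natrX. Qed.

(** Points with different first coordinates are orthogonal by [sum_alpha_trunc_mul]. With equal ones
    the summand does not depend on [a], which cancels one factor [q ^ (n + 1)], and the rest is at
    most the square of the l1 norm of [alpha]. *)
Lemma gram_incidence_row i :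
  \sum_i' `|\sum_j incidence_kernel i j * incidence_kernel i' j| <= 4 / q ^+ n.+1.
Proof.
have Q0 : 0 < q ^+ n.+1 by rewrite exprn_gt0 // q_gt0.
rewrite -(pair_bigA _ (fun x y => `|\sum_j incidence_kernel i j * incidence_kernel (x, y) j|)) /=.
rewrite (bigD1 i.1) //= [X in _ + X]big1 ?addr0; last first.
  move=> x xi; rewrite big1 // => y _; rewrite gram_incidence big1 ?mul0r ?normr0 // => c _.
  by rewrite sum_alpha_trunc_mul ?mulr0 // subr_eq0 eq_sym.
apply: (@le_trans _ _ (\sum_y (\sum_c `|alpha c| * `|alpha (c + (i.2 - y))|) / q ^+ n.+1)).
  apply: ler_sum => y _; rewrite gram_incidence /= subrr.
  have tm0 a : trunc_mul 0 a = 0 by rewrite /trunc_mul linear0 mul0r drop_poly0r linear0.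
  under eq_bigr => c _.
    under eq_bigr => a _ do rewrite tm0 addr0.
    rewrite sumr_const -mulr_natr card_V mulrA.
    over.
  rewrite /= -mulr_suml expr2 invfM mulrA mulfK ?gt_eqF // normrM [`|_^-1|]gtr0_norm ?invr_gt0 //.
  rewrite ler_pM2r ?invr_gt0 //; apply: le_trans (ler_norm_sum _ _ _) _.
  by apply: ler_sum => c _; rewrite normrM.
rewrite -mulr_suml ler_pM2r ?invr_gt0 // exchange_big /=.
have hs c : \sum_y `|alpha (c + (i.2 - y))| <= 2.
  rewrite (reindex_inj (inv_inj (subKr (c + i.2)))) /=.
  rewrite (eq_bigr (fun y => `|alpha y|)) ?sum_norm_alpha // => y _.
  by rewrite addrA subKr.
apply: (@le_trans _ _ (\sum_c `|alpha c| * 2)).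
  by apply: ler_sum => c _; rewrite -mulr_sumr ler_wpM2l.
by rewrite -mulr_suml; have := sum_norm_alpha; lra.
Qed.

End IncidenceKernel.

(** * Realisation of incidences by Heisenberg elements *)

Section HeisenbergElements.
Variables (F : finFieldType) (n : nat).
Local Notation V := 'rV[F]_n.+1.
Local Notation pF := {poly F}.
Implicit Types (x y a b : V).

(* The leading term fixes the degree at [n + 3], so that the central entry of
   [point_line_elt] dominates (by one) when [incidence i j] is the constant 1 and
   not when it is 0; the terms it creates there are absorbed into the central
   coordinates of [point_elt] and [line_elt]. *)
Definition shifted x : pF := 'X^2 * ('X^(n.+1) + rVpoly x).

Definition point_elt (i : V * V) : 'M[pF]_4 :=
  heis (shifted i.1) 0 ('X^4 * ('X^n * rVpoly i.2 - 'X^(n.+1) * rVpoly i.1 - 'X^(n.+1) * 'X^(n.+1))).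

Definition line_elt (j : V * V) : 'M[pF]_4 :=
  heis 0 (shifted j.1) ('X^4 * ('X^n * rVpoly j.2 + 'X^(n.+1) * rVpoly j.1)).

Lemma rVpoly_inj : injective (@rVpoly F n.+1).
Proof. exact: can_inj rVpolyK. Qed.

Lemma shifted_inj : injective shifted.
Proof.
move=> x x' /mulfI h; have X0 : 'X^2 != 0 :> pF by rewrite expf_neq0 ?polyX_eq0.
by apply/rVpoly_inj/(addrI 'X^(n.+1))/h.
Qed.

Lemma point_elt_inj : injective point_elt.
Proof.
have X0 k : 'X^k != 0 :> pF by rewrite expf_neq0 ?polyX_eq0.
move=> [x y] [x' y'] /matrixP e.
have /= ex := e 0 1; rewrite !mxE /= in ex; have {}ex := shifted_inj ex.
have /= ey := e 0 3; rewrite !mxE /= ex in ey.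
congr (_, _) => //; apply/rVpoly_inj/(mulfI (X0 n)).
by move/(mulfI (X0 4)): ey => /addIr/addIr.
Qed.

Lemma line_elt_inj : injective line_elt.
Proof.
have X0 k : 'X^k != 0 :> pF by rewrite expf_neq0 ?polyX_eq0.
move=> [x y] [x' y'] /matrixP e.
have /= ex := e 0 2; rewrite !mxE /= in ex; have {}ex := shifted_inj ex.
have /= ey := e 0 3; rewrite !mxE /= ex in ey.
congr (_, _) => //; apply/rVpoly_inj/(mulfI (X0 n)).
by move/(mulfI (X0 4)): ey => /addIr.
Qed.

(** All terms in ['X^(n.+1)] cancel, and the centre becomes ['X^4 * ('X^n * (b - y) - x * a)]; the
    low part of [x * a] survives as an error of degree below [n]. *)
Lemma point_line_elt (i j : V * V) : ginv (point_elt i) *m line_elt j =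
  heis (- shifted i.1) (shifted j.1)
    ('X^4 * ('X^n * rVpoly (incidence i j) - take_poly n (rVpoly i.1 * rVpoly j.1))).
Proof.
rewrite heisV heisM; congr heis; try ring.
have si (x : V) : (size (rVpoly x) <= n.+1)%N by apply: size_poly.
have sd : (size (drop_poly n (rVpoly i.1 * rVpoly j.1)) <= n.+1)%N.
  rewrite size_drop_poly; have := size_polyMleq (rVpoly i.1) (rVpoly j.1).
  by have := si i.1; have := si j.1; lia.
rewrite /incidence !linearB /= poly_rV_K //.
have e := poly_take_drop n (rVpoly i.1 * rVpoly j.1).
set t := take_poly n _ in e *; set d := drop_poly n _ in e *.
have -> : t = rVpoly i.1 * rVpoly j.1 - d * 'X^n by rewrite -e addrK.
rewrite /shifted; ring.
Qed.

Lemma size_shifted x : size (shifted x) = n.+4.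
Proof.
rewrite /shifted mulrC size_mulXn; last first.
  rewrite -size_poly_eq0 size_polyDl size_polyXn //; exact: leq_ltn_trans (size_poly _ _) _.
by rewrite size_polyDl size_polyXn //; exact: leq_ltn_trans (size_poly _ _) _.
Qed.

Lemma msize_heis u v z : msize (heis u v z : 'M[pF]_4) = maxn 1 (maxn (size u) (maxn (size v) (size z))).
Proof.
apply/eqP; rewrite eqn_leq; apply/andP; split.
  apply: msize_mx4; rewrite /= ?size_polyN !size_poly0 size_poly1 /=.
  by rewrite !leq_max !leqnn ?orbT.
have h := @size_le_msize F (heis u v z).
move: (h 0 0) (h 0 1) (h 0 2) (h 0 3); rewrite !mxE /= size_poly1; lia.
Qed.

(** The centre has degree at most [n + 3], the exact degree of the [shifted] coordinates. *)
Lemma msize_incident (i j : V * V) : incidence i j = 0 ->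
  msize (ginv (point_elt i) *m line_elt j) = n.+4.
Proof.
move=> e; rewrite point_line_elt e linear0 mulr0 sub0r msize_heis size_polyN !size_shifted.
have : (size ('X^4 * - take_poly n (rVpoly i.1 * rVpoly j.1))%R <= n.+4)%N.
  apply: leq_trans (size_polyMleq _ _) _; rewrite size_polyXn size_polyN.
  exact: (leq_add (leqnn 4) (size_take_poly n _)).
by move: (size _) => k; lia.
Qed.

(** Now ['X^4 * 'X^n] leads the centre, which dominates with degree [n + 4]. *)
Lemma msize_const_incident (i j : V * V) : incidence i j = const_row F n ->
  msize (ginv (point_elt i) *m line_elt j) = n.+4.+1.
Proof.
move=> e; rewrite point_line_elt e poly_rV_K ?size_poly1 // mulr1 msize_heis size_polyN !size_shifted.
set t := take_poly _ _; have st : (size t <= n)%N by apply: size_take_poly.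
have s1 : size ('X^n - t) = n.+1 by rewrite size_polyDl size_polyXn // size_polyN ltnS.
by rewrite mulrC size_mulXn -?size_poly_eq0 s1 //; lia.
Qed.

End HeisenbergElements.

(** * The length function and the decay of radial multipliers *)

Section Conclusion.
Variables (F : finFieldType) (R : realType).
Local Notation pF := {poly F}.
Implicit Types (g : 'M[pF]_4) (f : 'M[pF]_4 -> R[i]).

(** The identity is treated apart: its word length is 0 although its [msize] is 1. *)
Definition mlength g : R := if g == 1%:M then 0 else (msize g)%:R.

Lemma mlength_length_fun : length_fun mlength.
Proof.
split=> [g _|g h hg hh]; rewrite /mlength; first by case: ifP.
case: ifPn => [_|ngh]; first by rewrite addr_ge0 //; case: ifP.
have [g1|_] := eqVneq g 1%:M.
  by rewrite g1 mul1mx in ngh *; rewrite (negPf ngh) add0r.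
have [h1|_] := eqVneq h 1%:M; first by rewrite h1 mulmx1 addr0.
rewrite -natrD ler_nat; apply: leq_trans (msizeM _ _) _; exact: leq_pred.
Qed.

Lemma mlength_bilip : odd #|F| -> bilip_word mlength (gens F).
Proof.
move=> oddF; have [K hK] := word_length_le_msize oddF.
(* The 2 serves the upper bound: a nonempty word of length [m] has [msize] at most
   [m + 1 <= 2 * m]. *)
exists (K + 2)%:R; split; first by rewrite ltr0n addn2.
split=> [g hg w hw e|g hg]; rewrite /mlength.
  case: ifPn => [_|ng]; first by rewrite mulr_ge0.
  case: w hw e => [|a w] hw e; first by rewrite -e eqxx in ng.
  rewrite -natrM ler_nat.
  have : short (size (a :: w)) g by exists (a :: w).
  move/short_msize => /= h; nia.
case: ifPn => [/eqP ->|_]; first by exists [::]; rewrite mulr0; split.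
have [w [h1 h2 h3]] := hK g hg; exists w; split=> //.
by rewrite -natrM ler_nat (leq_trans h3) // leq_mul2r leq_addr orbT.
Qed.

Definition center_elt k : 'M[pF]_4 := heis 0 0 'X^k.

Lemma msize_center_elt k : msize (center_elt k) = k.+1.
Proof. by rewrite /center_elt msize_heis !size_poly0 size_polyXn; lia. Qed.

(** Size 1 is excluded because there the identity and the other matrices have different lengths. *)
Lemma radial_msize f g k : radial mlength f -> inSp4 g -> (0 < k)%N -> msize g = k.+1 ->
  f g = f (center_elt k).
Proof.
move=> rf hg k0 sg; apply: rf => //; first exact: heis_inSp4.
have n1 h : msize h = k.+1 -> (h == 1%:M) = false.
  by move=> sh; apply: contra_eqF sh => /eqP ->; rewrite msize1; lia.
by rewrite /mlength !n1 ?sg ?msize_center_elt.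
Qed.

(** This is [q ^ (2 / p - 1 / 2)]: per unit of [n], the rank contributes [q ^ (2 / p)] to the
    Schatten norm of the test matrix and the operator norm [q ^ (- 1 / 2)]. *)
Definition decay (p : R) : R := #|F|%:R `^ (2 / p) / Num.sqrt #|F|%:R.

Lemma decay_gt0 p : 0 < decay p.
Proof. by rewrite divr_gt0 ?powR_gt0 ?sqrtr_gt0 ?q_gt0. Qed.

Lemma decay_lt1 p : 4 < p -> decay p < 1.
Proof.
move=> p4; rewrite /decay -powR12_sqrt ?ltW ?q_gt0 // ltr_pdivrMr ?powR_gt0 ?q_gt0 // mul1r.
have r0 : 0 < 2^-1 - 2 / p by rewrite subr_gt0 ltr_pdivrMr; lra.
have -> : #|F|%:R `^ 2^-1 = #|F|%:R `^ (2^-1 - 2 / p) * #|F|%:R `^ (2 / p) :> R.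
  by rewrite -powRD ?subrK // gt_eqF ?q_gt0 // implybT.
rewrite -[ltLHS]mul1r ltr_pM2r ?powR_gt0 ?q_gt0 //.
have : 1 `^ (2^-1 - 2 / p) < #|F|%:R `^ (2^-1 - 2 / p) :> R.
  by apply: (gt0_ltr_powR r0); rewrite ?nnegrE ?q_gt1 ?ltW ?q_gt0.
by rewrite powR1.
Qed.

Lemma schur_kernel f (I J : finType) (g : I -> 'M[pF]_4) (h : J -> 'M[pF]_4) (A : I -> J -> R[i]) :
  schur f (kernel_mx g h A) = kernel_mx g h (fun i j => f (ginv (g i) *m h j) * A i j).
Proof.
apply/funext => x; apply/funext => y; rewrite /schur /kernel_mx mulr_sumr.
apply: eq_bigr => i _; rewrite mulr_sumr; apply: eq_bigr => j _.
have [->|_] := eqVneq x (g i); last by rewrite !mul0r mulr0.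
by have [->|_] := eqVneq y (h j); rewrite ?mul0r ?mulr0 ?mul0r ?mulr0 ?mul1r.
Qed.

(** The average of the entries of the Schur product, times its size [N], is the difference of the
    two values; it is bounded by the operator norm, then by the Schatten norm, then by [c] times
    that of the test matrix. *)
Lemma radial_step f p (c : R) n : radial mlength f -> 4 < p -> 0 <= c ->
  (forall T, (spnorm (@inSp4 F) p T < +oo ->
       spnorm (@inSp4 F) p (schur f T) <= c%:E * spnorm (@inSp4 F) p T)%E) ->
  cmod (f (center_elt n.+3) - f (center_elt n.+4)) <= 2 * c * decay p ^+ n.+1.
Proof.
move=> rf p4 c0 hf.
have p0 : 0 < p by lra.
have q0 := q_gt0 F R.
have Q0 : 0 < #|F|%:R ^+ n.+1 :> R by rewrite exprn_gt0.
pose g := @point_elt F n; pose h := @line_elt F n.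
have gi : injective g by apply: point_elt_inj.
have hi : injective h by apply: line_elt_inj.
have Dg i : inSp4 (g i) by apply: heis_inSp4.
have Dh j : inSp4 (h j) by apply: heis_inSp4.
pose A i j : R[i] := (@incidence_kernel F R n i j)%:C%C.
pose b : R := 2 / Num.sqrt #|F|%:R ^+ n.+1.
have b0 : 0 < b by rewrite divr_gt0 // exprn_gt0 // sqrtr_gt0.
have b2 : b ^+ 2 = 4 / #|F|%:R ^+ n.+1.
  rewrite /b expr_div_n -exprM mulnC exprM sqr_sqrtr ?ltW //; congr (_ / _); ring.
have opT : (opnorm (@inSp4 F) (kernel_mx g h A) <= b%:E)%E.
  apply: opnorm_kernel_le => // i; rewrite b2.
  apply: le_trans (gram_incidence_row R i); apply: ler_sum => i' _.
  rewrite (_ : \sum_j _ = (\sum_j incidence_kernel R i j * incidence_kernel R i' j)%:C%C).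
    by rewrite cmod_real.
  rewrite rmorph_sum; apply: eq_bigr => j _; rewrite rmorphM /=; congr (_ * _).
  by apply: conj_Creal; rewrite complex_real.
have cV : #|{: 'rV[F]_n.+1 * 'rV[F]_n.+1}| = (#|F| ^ n.+1 * #|F| ^ n.+1)%N.
  by rewrite card_prod card_mx mul1n.
set N := (#|F| ^ n.+1 * #|F| ^ n.+1)%N in cV.
have NE : N%:R = #|F|%:R ^+ n.+1 * #|F|%:R ^+ n.+1 :> R by rewrite natrM natrX.
have N0 : (0 < N)%N by rewrite -(ltr0n R) NE mulr_gt0.
have spT := spnorm_le p0 (ltW b0) (@kernel_mx_row R _ _ _ g h A) opT.
have := hf _ (le_lt_trans spT (ltry _)).
move/(le_trans (opnorm_le_spnorm (@inSp4 F) (schur f (kernel_mx g h A)) p0)).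
rewrite schur_kernel => /(le_trans (opnorm_kernel_ge gi hi Dg Dh _ N0 cV cV)).
have c0' : (0 <= c%:E)%E by rewrite lee_fin.
move/le_trans => /(_ _ (lee_wpmul2l c0' spT)); rewrite -EFinM lee_fin size_codom cV.
have -> : N%:R `^ p^-1 * b = 2 * decay p ^+ n.+1.
  rewrite NE -exprD -powR_mulrn ?ltW // -powRrM /b /decay expr_div_n.
  rewrite mulrCA; congr (_ * (_ / _)).
  rewrite -powR_mulrn ?powR_ge0 // -powRrM; congr (_ `^ _).
  by rewrite addnn -mul2n natrM; field; lra.
set s1 := f (center_elt n.+3); set s2 := f (center_elt n.+4).
have -> : \sum_i \sum_j f (ginv (g i) *m h j) * A i j = (s1 - s2) * (N%:R)%:C%C.
  rewrite -(pair_bigA _ (fun x y => \sum_j f (ginv (g (x, y)) *m h j) * A (x, y) j)) /=.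
  (* For each [a] exactly one [b] has incidence 0 and exactly one has incidence 1, so every row has
     the same sum. *)
  have row i : \sum_j f (ginv (g i) *m h j) * A i j = s1 - s2.
    have fE j : f (ginv (g i) *m h j) * A i j =
       (s1 * (incidence i j == 0)%:R - s2 * (incidence i j == const_row F n)%:R) / (#|F|%:R ^+ n.+1).
      have hgh : inSp4 (ginv (g i) *m h j) by apply/inSp4M/Dh/inSp4V.
      have cr0 : const_row F n != 0.
        by rewrite -(inj_eq (@rVpoly_inj F n)) poly_rV_K ?size_poly1 // linear0 oner_eq0.
      have AE : A i j = ((incidence i j == 0)%:R - (incidence i j == const_row F n)%:R) / (#|F|%:R ^+ n.+1).
        by rewrite /A /incidence_kernel /alpha rmorphM fmorphV rmorphXn rmorphB !rmorph_nat.
      rewrite AE; have [e|ne] := eqVneq (incidence i j) 0.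
        rewrite eq_sym e (negPf cr0) (radial_msize rf hgh _ (msize_incident e)) // -/s1.
        by rewrite subr0 mulr0 subr0 mulr1 mul1r.
      have [e|ne'] := eqVneq (incidence i j) (const_row F n).
        rewrite (radial_msize rf hgh _ (msize_const_incident e)) // -/s2.
        by rewrite !sub0r mulr0 mulr1 sub0r mulrA mulrN1.
      by rewrite subr0 mul0r mulr0 !mulr0 subr0 mul0r.
    under eq_bigr => j _ do rewrite fE.
    rewrite -(pair_bigA _ (fun a b => (s1 * (incidence i (a, b) == 0)%:R
       - s2 * (incidence i (a, b) == const_row F n)%:R) / (#|F|%:R ^+ n.+1))) /=.
    have inner (a : 'rV[F]_n.+1) : \sum_b' (s1 * (incidence i (a, b') == 0)%:R
       - s2 * (incidence i (a, b') == const_row F n)%:R) / (#|F|%:R ^+ n.+1) = (s1 - s2) / (#|F|%:R ^+ n.+1).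
      rewrite -mulr_suml; congr (_ / _).
      rewrite (reindex_inj (addIr (i.2 + trunc_mul i.1 a))) /= sumrB -!mulr_sumr.
      have ee d : incidence i (a, d + (i.2 + trunc_mul i.1 a)) = d.
        by rewrite /incidence /= addrA addrAC addrK addrK.
      have si (t : 'rV[F]_n.+1) : \sum_(c : 'rV[F]_n.+1) (c == t)%:R = 1 :> R[i].
        by rewrite (bigD1 t) //= eqxx big1 ?addr0 // => x /negPf ->.
      under eq_bigr => d _ do rewrite ee.
      under [X in _ - _ * X]eq_bigr => d _ do rewrite ee.
      by rewrite !si !mulr1.
    under eq_bigr => a _ do rewrite inner.
    rewrite sumr_const card_mx mul1n -[LHS]mulr_natr natrX divfK //.
    by rewrite expf_neq0 // pnatr_eq0 -lt0n -(ltr0n R).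
  under eq_bigr => x _ do under eq_bigr => y _ do rewrite row.
  by rewrite (pair_bigA _ (fun _ _ => s1 - s2)) /= sumr_const cV rmorph_nat mulr_natr.
rewrite cmodM cmod_real ger0_norm ?ler0n // mulfK ?pnatr_eq0 -?lt0n //.
by rewrite mulrCA mulrA.
Qed.

(** Keeping the term [- r ^ (n + d)] makes the induction on [d] close with equality. *)
Lemma telescope_geometric (u : nat -> R[i]) (K r : R) : r < 1 ->
  (forall n, cmod (u n - u n.+1) <= K * r ^+ n) ->
  forall n d, cmod (u n - u (n + d)%N) <= K / (1 - r) * (r ^+ n - r ^+ (n + d)).
Proof.
move=> r1 hu n; elim=> [|d IH]; first by rewrite addn0 !subrr cmod0 mulr0.
have -> : u n - u (n + d.+1)%N = (u n - u (n + d)%N) + (u (n + d)%N - u (n + d).+1).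
  by rewrite addrA subrK addnS.
apply: le_trans (cmodD _ _) _; apply: le_trans (lerD IH (hu _)) _.
rewrite addnS exprS le_eqVlt; apply/orP; left; apply/eqP; field.
by rewrite subr_eq0 gt_eqF.
Qed.

Lemma fin_supp_center_elt f : fin_supp f ->
  exists J, forall k, (J <= k)%N -> f (center_elt k) = 0.
Proof.
case=> s hs; exists (\max_(g <- s) msize g) => k hk; apply/eqP.
apply: contraTT hk => /(hs _ (heis_inSp4 _ _ _)) ks; rewrite -ltnNge.
by apply: leq_trans (leq_bigmax_seq _ ks isT); rewrite -/(center_elt k) msize_center_elt.
Qed.

End Conclusion.

Theorem theorem1p5 (F : finFieldType) (R : realType) :
  odd #|F| ->
  exists l : 'M[{poly F}]_4 -> R,
    [/\ length_fun l,
        (exists S : seq 'M[{poly F}]_4, all (@inSp4 F) S /\ bilip_word l S) &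
        forall p : R, 4 < p ->
          ~ exists (I : Type) (le : I -> I -> Prop) (f : I -> 'M[{poly F}]_4 -> R[i]),
              [/\ directed_set le,
                  (forall a, fin_supp (f a) /\ radial l (f a)),
                  (exists C : R, forall a, (schur_norm p (f a) <= C%:E)%E) &
                  net_to_one le f]].
Proof.
move=> oddF; exists (@mlength F R); split; first exact: mlength_length_fun.
  by exists (gens F); split; [exact: gens_inSp4|exact: mlength_bilip].
move=> p p4 [I [le [f [[_ le_refl _ _] hf [C hC] f1]]]].
set r := decay F p; have r0 : 0 < r := decay_gt0 F p; have r1 : r < 1 := decay_lt1 F p4.
(* The factor [r] absorbs the exponent [n + 1] of [radial_step]; the shift by 3 below is the lowest
   degree its elements reach. *)
pose K := 2 * (C + 1) * r.
have step a n : cmod (f a (center_elt F (n + 3)) - f a (center_elt F (n.+1 + 3))) <= K * r ^+ n.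
  have [_ rf] := hf a.
  (* The infimum may not be attained; the slack 1 yields an actual constant [c < C + 1]. *)
  have : (schur_norm p (f a) < (C + 1)%:E)%E.
    by apply: le_lt_trans (hC a) _; rewrite lte_fin ltrDl.
  move=> /ereal_inf_lt[_ [c [c0 hc] <-]]; rewrite lte_fin => cC.
  rewrite addn3 addSn addn3; apply: le_trans (radial_step n rf p4 c0 hc) _.
  rewrite /K -/r exprS mulrA ler_pM2r ?exprn_gt0 // ler_pM2r // ler_pM2l //; exact: ltW.
(* The sign of [C] is not given; an index supplied by convergence at the identity shows [K >= 0]. *)
have K0 : 0 <= K / (1 - r).
  have [a _] := f1 1%:M (inSp4_1 F) 1 ltr01.
  have := le_trans (cmod_ge0 _) (step a 0%N); rewrite expr0 mulr1 => K0.
  by rewrite divr_ge0 // subr_ge0 ltW.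
have small a n : cmod (f a (center_elt F (n + 3))) <= K / (1 - r) * r ^+ n.
  have [J hJ] := fin_supp_center_elt (hf a).1.
  have := telescope_geometric r1 (step a) n J; rewrite /= (hJ (n + J + 3)%N); last by lia.
  rewrite subr0 => /le_trans; apply; apply: ler_wpM2l => //.
  by rewrite gerBl exprn_ge0 // ltW.
have [n hn] : exists n, K / (1 - r) * r ^+ n < 1 / 2.
  have r1' : `|r| < 1 by rewrite gtr0_norm.
  have /cvgr0Pnorm_lt := cvg_expr r1'.
  have e0 : 0 < 1 / 2 / (K / (1 - r) + 1) by rewrite divr_gt0 //; lra.
  move=> hr; have [n _ hn] := hr _ e0; exists n.
  have := hn n (leqnn n); rewrite /= gtr0_norm ?exprn_gt0 // ltr_pdivlMr; last by lra.
  have := exprn_gt0 n r0; lra.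
(* The degree was fixed before the index: at [a0] the value is within [1 / 2] of 1, yet has modulus
   below [1 / 2]. *)
have [a0 /(_ _ (le_refl a0)) h1] := f1 (center_elt F (n + 3)) (heis_inSp4 _ _ _) (1 / 2) ltac:(lra).
have h2 := le_lt_trans (small a0 n) hn.
set z := f a0 _ in h1 h2.
have : cmod (1 : R[i]) <= cmod z + cmod (z - 1).
  by rewrite -[X in cmod X <= _](subKr z) addrC -(cmodN (z - 1)) addrC; exact: cmodD.
rewrite [cmod 1](ComplexField.Normc.normc1 R); lra.
Qed.
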